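(* Let $Q(x,y)$ be a real indefinite binary quadratic form such that the origin $O$ is the only point of $\mathbb{Z}^2$ lying on the pair of lines $\{Q(x,y)=0\}$. Consider the Arnold sail of this pair of lines (that is, the sail of one of the four angles formed by the two lines; any choice), and let $(a_i)_{i\in\mathbb{Z}}$ be its LLS (lattice length sine) sequence. Then $(a_i)_{i\in\mathbb{Z}}$ coincides with the sequence of left- and right-turns of the Conway river on the topograph of $Q$. That is, up to a shift of the index and up to the choice of orientation of the sail and of direction of the river (i.e. reversal of the order of the sequence), $(a_i)_{i\in\mathbb{Z}}$ is the bi-infinite sequence of lengths of the successive maximal blocks of consecutive equal turns made along the river: $a_i$ turns to one side, followed by $a_{i+1}$ turns to the other side, followed by $a_{i+2}$ turns to the first side, and so on. Moreover, this determines the river uniquely up to the action of $PGL(2,\mathbb{Z})$ on the topograph and a change of direction. That is, if $Q'$ is another real indefinite binary quadratic form whose zero lines contain no point of $\mathbb{Z}^2$ other than $O$, and the turn sequence of the Conway river of $Q'$ is also $(a_i)_{i\in\mathbb{Z}}$ (up to a shift of the index and reversal of order), then some element of $PGL(2,\mathbb{Z})$ maps the river of $Q$ onto the river of $Q'$ as undirected paths in the superbase tree.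
   Context: **Forms.** $Q(x,y)=ax^2+hxy+by^2$ with $a,h,b\in\mathbb{R}$; indefinite means that $Q$ takes both positive and negative values on $\mathbb{R}^2$ and is nondegenerate, so that $\{Q=0\}$ is a pair of distinct lines through the origin $O$, forming four angles. Under the assumption on integer points, $Q(v)\neq 0$ for all $v\in\mathbb{Z}^2\setminus\{0\}$. **Integer length and integer sine.** For distinct points $A,B\in\mathbb{Z}^2$, the integer length $\mathrm{l}l(AB)$ is the number of points of $\mathbb{Z}^2$ in the interior of the segment $AB$, plus one. For $A,B,C\in\mathbb{Z}^2$ not collinear, the integer area $\mathrm{l}S(\triangle ABC)$ is the index in $\mathbb{Z}^2$ of the sublattice generated by the vectors $AB$ and $BC$, i.e. $|\det(AB,BC)|$. The integer sine is $$\mathrm{l}\sin\angle ABC=\frac{\mathrm{l}S(\triangle ABC)}{\mathrm{l}l(AB)\,\mathrm{l}l(BC)}=\frac{|\det(AB,BC)|}{\mathrm{l}l(AB)\,\mathrm{l}l(BC)},$$ a positive integer depending only on the angle. **Arnold sail.** For one of the angles (planar sectors with vertex $O$) formed by two lines through $O$ containing no integer points other than $O$, the Arnold sail is the boundary of the convex hull of all integer points inside the angle, excluding $O$. It is an infinite broken line with vertices $(A_i)_{i\in\mathbb{Z}}$ in $\mathbb{Z}^2$, listed in order along the sail. **LLS sequence.** The LLS sequence $(a_i)_{i\in\mathbb{Z}}$ of the angle (of the sail) is the sequence of positive integers $$a_{2k}=\mathrm{l}l(A_kA_{k+1}),\qquad a_{2k-1}=\mathrm{l}\sin(\angle A_{k-1}A_kA_{k+1}),\qquad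 k\in\mathbb{Z}.$$ It is defined up to a shift of indices and depends on the orientation of the sail (reversing the orientation reverses the sequence). The sails of the four angles formed by a pair of lines are isomorphic or dual to each other (duality exchanges integer lengths of edges and integer sines of angles). **Superbase tree and topograph.** A lax vector is a pair $\pm v$ with $v\in\mathbb{Z}^2$. A superbase of $\mathbb{Z}^2$ is a triple of lax vectors $(\pm e_1,\pm e_2,\pm e_3)$ such that $(e_1,e_2)$ is a basis of $\mathbb{Z}^2$ and $e_1+e_2+e_3=0$. Each basis $(\pm e_1,\pm e_2)$ is contained in exactly two superbases, $(\pm e_1,\pm e_2,\pm(e_1+e_2))$ and $(\pm e_1,\pm e_2,\pm(e_1-e_2))$. The superbase tree is the graph whose vertices are the superbases and whose edges are the bases $(\pm e_1,\pm e_2)$ (up to signs and order), each edge joining the two superbases containing it. It is an infinite trivalent tree, embedded in the plane so that the connected components of its complement (regions) correspond bijectively to the primitive lax vectors, with the edge $(\pm e_1,\pm e_2)$ separating the regions labelled $\pm e_1$ and $\pm e_2$, and with the vertex $(\pm e_1,\pm e_2,\pm e_3)$ adjacent to the regions labelled $\pm e_1,\pm e_2,\pm e_3$. The topograph of $Q$ is this embedded tree with each region $\pm v$ labelled by the value $Q(v)=Q(-v)$. **Conway river.** When $Q$ is indefinite and $Q(v)\ne0$ for all $v\in\mathbb{Z}^2\setminus\{0\}$, the edges of the tree separating a region with a positive value of $Q$ from a region with a negative value form a bi-infinite path, called the Conway river of $Q$. When the river is traversed in a chosen direction, at each vertex on it one turns either left or right (onto the left or the right of the two other edges at that vertex in the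 planar embedding), giving a bi-infinite word in the letters $L,R$. **Action of $PGL(2,\mathbb{Z})$.** The group $PGL(2,\mathbb{Z})=GL(2,\mathbb{Z})/\{\pm I\}$ acts on lax vectors by $\pm v\mapsto\pm gv$, hence on bases and superbases, and thus on the superbase tree. Elements of determinant $1$ preserve the orientation of the planar embedding and elements of determinant $-1$ reverse it (swapping left and right turns). *)

(* Defs.v *)
(* MathComp-Analysis; the real numbers are an arbitrary R : realType.
   Vectors are columns; bi-infinite sequences are functions on int. *)
From HB Require Import structures.
From mathcomp Require Import all_boot all_order all_algebra.
From mathcomp Require Import finmap.
From mathcomp Require Import all_classical all_reals all_analysis.

Set Implicit Arguments.
Unset Strict Implicit.
Unset Printing Implicit Defensive.

Import Order.TTheory GRing.Theory Num.Theory.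
Import numFieldNormedType.Exports.

Local Open Scope classical_set_scope.
Local Open Scope ring_scope.

Definition mx2 (K : Type) (u v : 'cV[K]_2) : 'M[K]_2 := row_mx u v.

Definition det2 (K : comNzRingType) (u v : 'cV[K]_2) : K := \det (mx2 u v).

Definition real_pt (R : realType) (v : 'cV[int]_2) : 'cV[R]_2 :=
  map_mx intr v.

(** ** Binary quadratic forms *)

Record bqf (R : realType) := Bqf { bqf_a : R; bqf_h : R; bqf_b : R }.

Definition bqf_eval (R : realType) (Q : bqf R) (v : 'cV[R]_2) : R :=
  let x := v 0 0 in let y := v 1 0 in
  bqf_a Q * x ^+ 2 + bqf_h Q * x * y + bqf_b Q * y ^+ 2.

Coercion bqf_eval : bqf >-> Funclass.

Definition indefinite (R : realType) (Q : bqf R) : Prop :=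
  [/\ exists v, 0 < Q v, exists v, Q v < 0
    & bqf_h Q ^+ 2 - 4 * bqf_a Q * bqf_b Q != 0].

Definition no_integer_zero (R : realType) (Q : bqf R) : Prop :=
  forall v : 'cV[int]_2, Q (real_pt R v) = 0 -> v = 0.

(** ** Integer length and integer sine *)

Definition segment (R : realType) (A B : 'cV[R]_2) : set 'cV[R]_2 :=
  [set P | exists t : R, [/\ 0 <= t, t <= 1 & P = (1 - t) *: A + t *: B]].

Definition open_segment (R : realType) (A B : 'cV[R]_2) : set 'cV[R]_2 :=
  [set P | exists t : R, [/\ 0 < t, t < 1 & P = (1 - t) *: A + t *: B]].

(* A bounded segment contains finitely many integer points, so fset_set is not
   in its default case (infinite sets). *)
Definition integer_length (R : realType) (A B : 'cV[int]_2) : nat :=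
  #|` fset_set [set P : 'cV[int]_2 |
        open_segment (real_pt R A) (real_pt R B) (real_pt R P)] |.+1.

Definition integer_area (A B C : 'cV[int]_2) : nat :=
  `|det2 (B - A) (C - B)|%N.

(* The division is exact: AB is integer_length A B times an integer vector. *)
Definition integer_sine (R : realType) (A B C : 'cV[int]_2) : nat :=
  (integer_area A B C %/ (integer_length R A B * integer_length R B C))%N.

(** ** Arnold sails and LLS sequences *)

(* When Q is indefinite, two independent zeros of Q span the two lines
   {Q = 0}, and the four choices of signs for them give the four angles. *)
Definition is_angle (R : realType) (Q : bqf R) (C : set 'cV[R]_2) : Prop :=
  exists u w : 'cV[R]_2,
    [/\ Q u = 0, Q w = 0, det2 u w != 0 &
        C = [set P | exists s t : R,
               [/\ 0 <= s, 0 <= t & P = s *: u + t *: w]]].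

Definition convex_hull (R : realType) (S : set 'cV[R]_2) : set 'cV[R]_2 :=
  smallest (@convex_set R 'cV[R]_2) S.

Definition boundary (T : topologicalType) (S : set T) : set T :=
  closure S `\` interior S.

Definition sail (R : realType) (C : set 'cV[R]_2) : set 'cV[R]_2 :=
  boundary (convex_hull
    [set real_pt R v | v in [set v : 'cV[int]_2 | v != 0 /\ C (real_pt R v)]]).

(* A lists, in order, the vertices of the broken line S: the edges
   A_i A_(i+1) cover S, distinct edges only share the common endpoint of
   consecutive ones, and S has a genuine corner at every A_i.  This determines
   A up to a shift and a reversal of the index. *)
Definition broken_line_vertices (R : realType) (S : set 'cV[R]_2)
    (A : int -> 'cV[int]_2) : Prop :=
  let edge i := segment (real_pt R (A i)) (real_pt R (A (i + 1))) in
  [/\ S = \bigcup_(i in [set: int]) edge i,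
      forall i, det2 (A i - A (i - 1)) (A (i + 1) - A i) != 0
    & forall i j P, i < j -> edge i P -> edge j P ->
        j = i + 1 /\ P = real_pt R (A j)].

Definition is_LLS (R : realType) (C : set 'cV[R]_2) (a : int -> nat) : Prop :=
  exists A : int -> 'cV[int]_2,
    broken_line_vertices (sail C) A /\
    forall k : int,
      a (2 * k) = integer_length R (A k) (A (k + 1)) /\
      a (2 * k - 1) = integer_sine R (A (k - 1)) (A k) (A (k + 1)).

(** ** The superbase tree *)

Definition lax_vector : Type := set 'cV[int]_2.

Definition lax (v : 'cV[int]_2) : lax_vector := [set v; - v].

(* Over int, mx2 u v \in unitmx says that (u, v) is a basis of Z^2. *)
Definition is_basis (E : set lax_vector) : Prop :=
  exists u v, mx2 u v \in unitmx /\ E = [set lax u; lax v].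

Definition is_superbase (V : set lax_vector) : Prop :=
  exists u v w, [/\ mx2 u v \in unitmx, u + v + w = 0
                  & V = [set lax u; lax v; lax w]].

Definition joins (E V W : set lax_vector) : Prop :=
  [/\ is_basis E, is_superbase V, is_superbase W, V <> W & E `<=` V `&` W].

Inductive turn := TurnL | TurnR.

(* The planar embedding is encoded by its rotation system: for x + y + z = 0
   and det(x, y) = 1, the regions x, y, z occur in this counterclockwise order
   around the vertex {x, y, z}; the condition is invariant under cyclic
   permutation and global sign change.  Arriving at that vertex along the edge
   {x, y}, one has the region x on the left, y on the right and z ahead, so
   the edge {x, z} is the left exit and {y, z} the right one. *)
Definition turns (E V E' : set lax_vector) (d : turn) : Prop :=
  exists x y z : 'cV[int]_2,
    [/\ det2 x y = 1, x + y + z = 0,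
        V = [set lax x; lax y; lax z], E = [set lax x; lax y]
      & E' = match d with
             | TurnL => [set lax x; lax z]
             | TurnR => [set lax y; lax z]
             end].

(** ** The Conway river *)

(* The value of Q on a region is its value at either representative. *)
Definition river (R : realType) (Q : bqf R) : set (set lax_vector) :=
  [set E | exists u v, [/\ mx2 u v \in unitmx, E = [set lax u; lax v],
                           0 < Q (real_pt R u) & Q (real_pt R v) < 0]].

(* A traversal of the river as a bi-infinite simple path: the edge e i goes
   from the vertex p i to the vertex p (i + 1). *)
Definition river_traversal (R : realType) (Q : bqf R)
    (p e : int -> set lax_vector) : Prop :=
  [/\ forall i, joins (e i) (p i) (p (i + 1)), injective p
    & river Q = [set e i | i in [set: int]]].

Definition turn_word (p e : int -> set lax_vector) (w : int -> turn) : Prop :=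
  forall i, turns (e (i - 1)) (p i) (e i) (w i).

(* The i-th maximal block of w occupies the indices s i <= j < s (i + 1). *)
Definition block_lengths (w : int -> turn) (a : int -> nat) : Prop :=
  (forall i, (0 < a i)%N) /\
  exists s : int -> int,
    [/\ forall i, s (i + 1) = s i + (a i)%:Z,
        forall i j, s i <= j < s (i + 1) -> w j = w (s i)
      & forall i, w (s (i + 1)) <> w (s i)].

Definition river_blocks (R : realType) (Q : bqf R) (a : int -> nat) : Prop :=
  exists p e w, [/\ river_traversal Q p e, turn_word p e w
                  & block_lengths w a].

Definition shift_reversal_equiv (a b : int -> nat) : Prop :=
  exists k : int, (forall i, b i = a (k + i)) \/ (forall i, b i = a (k - i)).

(** ** The action of GL(2, Z) *)

(* Since lax v = lax (- v), g and - g act in the same way: this is the action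
   of the class of g in PGL(2, Z). *)
Definition act_lax (g : 'M[int]_2) (l : lax_vector) : lax_vector :=
  [set g *m v | v in l].

Definition act_edge (g : 'M[int]_2) (E : set lax_vector) : set lax_vector :=
  [set act_lax g l | l in E].

(* Main.v *)
Require Import Defs.
From HB Require Import structures.
From mathcomp Require Import all_boot all_order all_algebra.
From mathcomp Require Import all_classical all_reals all_analysis.
From mathcomp Require Import ring lra zify.
Import Order.TTheory GRing.Theory Num.Theory.
Import numFieldNormedType.Exports.
Local Open Scope classical_set_scope.
Local Open Scope ring_scope.

(** Write Q = B f g with linear forms f and g, so that the sector C is
    {f >= 0, g >= 0}.  Since Q has no integer zero, f and g vanish at no
    nonzero integer vector.  An edge of the river is a basis with one vector
    (up to sign) inside C and one outside, hence it has a unique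
    representative (u, v) with f > 0 on both, g u > 0 and g v < 0
    ([river_pairs]).  The river then flows by the subtractive algorithm: the
    next pair is (u + v, v) or (u, u + v), whichever keeps the signs of g, and
    the previous pair is (u - v, v) or (u, v - u), whichever keeps f positive.
    Any two such pairs are linked by this flow, because their change of basis
    or its inverse has nonnegative entries and determinant 1
    ([river_connected]); so the river is a single bi-infinite path
    ([orbit_traversal]), and the side of each turn tells which of the two
    vectors has been replaced ([turn_next]).

    The sail is what the flow leaves behind in C.  Let A_k be its vertices and
    v_k the primitive vector along the edge A_k A_(k+1).  An edge supports the
    convex hull of the integer points of C; from this
    - v_k and - v_k are outside C, as the line of the edge would otherwise have
      integer points of C on both sides ([sector_both_sides]);
    - det(v_k, A_k) is 1 or -1, since otherwise the triangle with vertices O,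
      A_k, A_k + v_k would contain an integer point strictly below the edge
      ([lowest_triangle_unimodular]);
    - consecutive edges advance in the same direction and
      v_k = v_(k-1) + lsin * A_k ([sail_vertex]).
    Thus (A_k, v_k) is a river pair, from which the flow replaces the first
    vector ll(A_k A_(k+1)) times, up to (A_(k+1), v_k), and then the second one
    lsin times, up to (A_(k+1), v_(k+1)).  These numbers are the LLS sequence
    and the lengths of the blocks of equal turns ([sail_blocks]).

    Conversely, a pair representing an edge and the next turn determine the
    next pair up to sign, so a turn word determines its path up to the initial
    basis, that is, up to GL(2, Z) ([same_word_same_path]).  The block lengths
    determine the word up to a shift and an exchange of L and R; this exchange
    and the reversal of the path are changes of basis of determinant -1
    ([turn_path_flip], [turn_path_reverse]). *)

Set Implicit Arguments.
Unset Strict Implicit.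
Unset Printing Implicit Defensive.

Local Notation ivec := 'cV[int]_2.

(** * Plane vectors and lax vectors *)

Lemma ord2_cases (i : 'I_2) : i = 0 \/ i = 1.
Proof.
by case: i => [[|[|//]] hi]; [left|right]; apply/val_inj.
Qed.

Lemma cV2P (K : Type) (u v : 'cV[K]_2) :
  u 0 0 = v 0 0 -> u 1 0 = v 1 0 -> u = v.
Proof.
by move=> h0 h1; apply/matrixP => i j; rewrite ord1; case: (ord2_cases i) => ->.
Qed.

Lemma det2E (K : comNzRingType) (u v : 'cV[K]_2) :
  det2 u v = u 0 0 * v 1 0 - v 0 0 * u 1 0.
Proof.
have E0 (x y : 'cV[K]_2) i : mx2 x y i 0 = x i 0.
  by rewrite [LHS]mxE; case: splitP => // j; rewrite ord1 => _.
have E1 (x y : 'cV[K]_2) i : mx2 x y i 1 = y i 0.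
  by rewrite [LHS]mxE; case: splitP => [[[]]//|j]; rewrite ord1 => _.
have D (M : 'M[K]_2) : \det M = M 0 0 * M 1 1 - M 0 1 * M 1 0.
  rewrite (expand_det_row _ 0) !big_ord_recl big_ord0 /cofactor !det_mx11.
  rewrite !mxE /= addr0.
  have -> : lift ord0 ord0 = 1 :> 'I_2 by apply/val_inj.
  have -> : lift 1 0 = 0 :> 'I_2 by apply/val_inj.
  rewrite expr0 expr1; ring.
rewrite /det2 D !E0 !E1; ring.
Qed.

Lemma cramer2 (u v w : ivec) : det2 u v *: w = det2 w v *: u + det2 u w *: v.
Proof. by apply: cV2P; rewrite !det2E !mxE; ring. Qed.

Lemma int_bi_ind (P : int -> Prop) (i0 : int) :
  P i0 -> (forall i, P i <-> P (i + 1)) -> forall i, P i.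
Proof.
move=> P0 PS i; rewrite -(subrK i0 i); elim/int_ind: (i - i0) => [|n IH|n IH].
- by rewrite add0r.
- by have /PS := IH; congr P; lia.
- by apply/PS; move: IH; congr P; lia.
Qed.

Lemma mx2_unitP (u v : ivec) :
  mx2 u v \in unitmx <-> det2 u v = 1 \/ det2 u v = -1.
Proof.
rewrite unitmxE -/(det2 u v); split.
- by move=> /(orP (b1 := _ == 1)) [] /eqP; [left|right].
- by move=> [] ->.
Qed.

Lemma laxN (v : ivec) : lax (- v) = lax v.
Proof. by rewrite /lax opprK setUC. Qed.

Lemma lax_eq (u v : ivec) : lax u = lax v -> u = v \/ u = - v.
Proof. by move=> h; have : lax u u by [left]; rewrite h. Qed.

(** * Turn words *)

Definition flip_turn (d : turn) : turn :=
  if d is TurnL then TurnR else TurnL.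

Definition edge (m : ivec * ivec) : set lax_vector := [set lax m.1; lax m.2].

(** The third region at the endpoint of the edge (m.1, m.2) where it is ahead; the
    other endpoint carries m.1 - m.2 instead. *)
Definition vertex (m : ivec * ivec) : set lax_vector :=
  [set lax m.1; lax m.2; lax (m.1 + m.2)].

(** With m.1 on the left of the edge and m.2 on the right, the new region ahead
    m.1 + m.2 becomes the right one after a left turn, the left one after a right
    turn. *)
Definition turn_step (d : turn) (m : ivec * ivec) : ivec * ivec :=
  match d with
  | TurnL => (m.1, m.1 + m.2)
  | TurnR => (m.1 + m.2, m.2)
  end.

Definition signed (b : bool) (m : ivec * ivec) : ivec * ivec :=
  if b then (- m.1, - m.2) else m.

Lemma edge_signed b m : edge (signed b m) = edge m.
Proof. by case: b; rewrite // /edge /= !laxN. Qed.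

Lemma vertex_signed b m : vertex (signed b m) = vertex m.
Proof. by case: b; rewrite // /vertex /= -opprD !laxN. Qed.

Lemma edge_swap (m : ivec * ivec) : edge (m.2, m.1) = edge m.
Proof. by rewrite /edge /= setUC. Qed.

Lemma edge_neg2 (m : ivec * ivec) : edge (m.1, - m.2) = edge m.
Proof. by rewrite /edge /= laxN. Qed.

Lemma lax_edge u m : edge m (lax u) ->
  [\/ u = m.1, u = - m.1, u = m.2 | u = - m.2].
Proof.
case=> /lax_eq [] ->; [exact: Or41|exact: Or42|exact: Or43|exact: Or44].
Qed.

(** An oriented basis of an edge is determined up to sign and up to the direction
    in which the edge is traversed: the second case is the opposite direction,
    with left and right regions exchanged. *)
Lemma edge_eq_oriented (a b c d : ivec) :
  det2 a b = 1 -> det2 c d = 1 -> edge (a, b) = edge (c, d) ->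
  (exists s, (c, d) = signed s (a, b)) \/ (exists s, (c, d) = signed s (b, - a)).
Proof.
move=> dab dcd E.
have /lax_edge /= hc : edge (a, b) (lax c) by rewrite E; left.
have /lax_edge /= hd : edge (a, b) (lax d) by rewrite E; right.
have {E} : det2 c d = det2 a b by rewrite dab.
move: dab {dcd}; rewrite !det2E.
case: hc => ->; case: hd => ->; rewrite ?mxE ?(mulrN, mulNr, opprK) => /= h1 h2;
  try lia.
all: try (left; exists false; done).
all: try (left; exists true; done).
all: try (right; exists false; done).
by right; exists true; rewrite /= opprK.
Qed.

(** Pairs are only linked up to sign, as an edge determines its basis up to sign;
    choosing coherent signs would require a recursion in both directions.  The
    determinant may be -1, so that mirror images of paths are paths. *)
Definition turn_path (M : int -> ivec * ivec) (w : int -> turn) : Prop :=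
  (forall i, mx2 (M i).1 (M i).2 \in unitmx) /\
  forall i, exists s, M (i + 1) = signed s (turn_step (w (i + 1)) (M i)).

Lemma traversal_turn_path (R : realType) (Q : bqf R) p e w :
  river_traversal Q p e -> turn_word p e w ->
  exists M, turn_path M w /\ river Q = [set edge (M i) | i in [set: int]].
Proof.
move=> [jn _ ->] tw.
have /boolp.choice [M MP] : forall i, exists m : ivec * ivec,
    [/\ det2 m.1 m.2 = 1, e i = edge m, p (i + 1) = vertex m
      & e (i + 1) = edge (turn_step (w (i + 1)) m)].
  move=> i; have := tw (i + 1); rewrite addrK => -[x [y [z [dxy xyz pE eE e'E]]]].
  have zE : lax z = lax (x + y).
    by rewrite -laxN; congr lax; apply/eqP; rewrite eq_sym -addr_eq0 xyz.
  exists (x, y); split => //; first by rewrite pE zE.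
  rewrite e'E; case: (w (i + 1)); rewrite /edge /= zE //.
  by rewrite setUC.
exists M; split; last first.
  by apply: eq_imagel => i _; have [_ ->] := MP i.
split=> [i|i]; first by apply/mx2_unitP; left; have [] := MP i.
have [d1 e1 p1 e2] := MP i; have [d1' e1' p1' _] := MP (i + 1).
have np : p (i + 1) <> p (i + 1 + 1) by have [] := jn (i + 1).
have dS : det2 (turn_step (w (i + 1)) (M i)).1 (turn_step (w (i + 1)) (M i)).2 = 1.
  by move: d1; rewrite !det2E; case: (w (i + 1)) => /= h; rewrite !mxE /=; move: h; lia.
have := edge_eq_oriented dS d1'.
rewrite -!surjective_pairing => /(_ _) [||[s sE]]; first by rewrite -e2 -e1'.
  by [].
(* in the opposite direction the region ahead would be the one left behind,
   so the path would return to the vertex it comes from *)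
case: np; rewrite p1 p1' sE {e1 e2 p1 p1' e1' d1' sE d1 dS}.
rewrite vertex_signed; case: (M i) => x y; case: (w (i + 1)); rewrite /vertex /=.
- by rewrite addrAC subrr add0r laxN setUC setUA.
- by rewrite [in lax (y - _)]opprD addrCA subrr addr0 !laxN -setUA setUC -setUA.
Qed.

(** Exchanging the two vectors of each basis is a reflection. *)
Lemma turn_path_flip (M : int -> ivec * ivec) (w : int -> turn) :
  turn_path M w ->
  turn_path (fun i => ((M i).2, (M i).1)) (fun i => flip_turn (w i)).
Proof.
move=> [uM sM]; split=> i.
  have /mx2_unitP := uM i; rewrite mx2_unitP !det2E /=; lia.
have [s ->] := sM i; exists s.
by case: s; case: (w (i + 1)) => /=; rewrite ?(addrC (M i).2).
Qed.

(** Changing the sign of the second vector turns the step (x, y) -> (x + y, y),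
    taken backwards, into (x + y, - y) -> (x, - y), a step of the same kind; the
    same holds for the other step. *)
Lemma turn_path_reverse (M : int -> ivec * ivec) (w : int -> turn) :
  turn_path M w ->
  turn_path (fun i => ((M (- i)).1, - (M (- i)).2)) (fun i => w (1 - i)).
Proof.
move=> [uM sM]; split=> i.
  have /mx2_unitP := uM (- i); rewrite mx2_unitP !det2E /= !mxE /=; lia.
have [s] := sM (- (i + 1)).
have -> : - (i + 1) + 1 = - i by lia.
have -> : 1 - (i + 1) = - i by lia.
by case: s => ->; [exists true|exists false]; case: (w (- i)) => /=;
  rewrite ?(opprK, opprD, addrK, addNKr, addKr, addrNK, subrr, addr0).
Qed.

Lemma act_edgeE (g : 'M[int]_2) (m : ivec * ivec) :
  act_edge g (edge m) = edge (g *m m.1, g *m m.2).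
Proof.
have E v : act_lax g (lax v) = lax (g *m v).
  by rewrite /act_lax /lax image_setU !image_set1 mulmxN.
by rewrite /act_edge /edge image_setU !image_set1 !E.
Qed.

(** Steps commute with the left action of GL(2, Z), so the quotient of two paths
    with the same word is constant up to sign; g is its value at 0. *)
Lemma same_word_same_path (M M' : int -> ivec * ivec) (w w' : int -> turn) (c : int) :
  turn_path M w -> turn_path M' w' -> (forall j, w' j = w (j + c)) ->
  exists g : 'M[int]_2, g \in unitmx /\
    forall j, edge (M' j) = act_edge g (edge (M (j + c))).
Proof.
move=> [uM sM] [uM' sM'] ww.
pose X m : 'M[int]_2 := mx2 m.1 m.2.
pose g := X (M' 0) *m invmx (X (M c)).
pose G (m : ivec * ivec) := (g *m m.1, g *m m.2).
exists g; split; first by rewrite unitmx_mul uM' unitmx_inv uM.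
suff H j : exists s, M' j = signed s (G (M (j + c))).
  by move=> j; have [s ->] := H j; rewrite edge_signed act_edgeE.
have Gs s m : G (signed s m) = signed s (G m) by case: s; rewrite // /G /= !mulmxN.
have Gt d m : G (turn_step d m) = turn_step d (G m).
  by case: d; rewrite /G /= mulmxDr.
have ts d s m : turn_step d (signed s m) = signed s (turn_step d m).
  by case: d; case: s; rewrite //= -opprD.
have ss s t m : signed s (signed t m) = signed (s (+) t) m.
  by case: s; case: t; rewrite //= !opprK -surjective_pairing.
have tinj d : injective (turn_step d).
  move=> [x y] [x' y']; case: d => /= -[].
  - by move=> -> /addrI ->.
  - by move=> + yy; rewrite yy => /addIr ->.
move: j; apply: (int_bi_ind (i0 := 0)) => [|j].
  exists false; rewrite add0r /=.
  have : X (M' 0) = g *m X (M c) by rewrite /g mulmxKV // uM.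
  move=> E; have : row_mx (M' 0).1 (M' 0).2 = g *m row_mx (M c).1 (M c).2 := E.
  rewrite mul_mx_row => /eq_row_mx[E1 E2].
  by rewrite /G -E1 -E2 -surjective_pairing.
have [s1 E1] := sM' j; have [s2] := sM (j + c).
have -> : j + c + 1 = j + 1 + c by lia.
move=> E2; rewrite E1 E2 ww; split => -[s].
- move=> ->; rewrite ts ss -Gt Gs; exists (s1 (+) s (+) s2).
  by rewrite ss -addbA addbb addbF.
- rewrite Gs Gt ss => E; exists (s1 (+) (s (+) s2)).
  by apply: (@tinj (w (j + 1 + c))); rewrite ts -ss -E ss addbb.
Qed.

(** * Block lengths *)

(** The letter changes at each block boundary, so the word is known from the block
    boundaries and the letter of one block. *)
Lemma block_lengths_word (w w' : int -> turn) (a b : int -> nat) (k : int) :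
  block_lengths w a -> block_lengths w' b -> (forall i, b i = a (k + i)) ->
  exists c : int, (forall j, w' j = w (j + c)) \/
    (forall j, w' j = flip_turn (w (j + c))).
Proof.
move=> [a0 [s [sS sw sn]]] [b0 [s' [sS' sw' sn']]] ba.
(* the shift aligning the block 0 of w' with the block k of w *)
have [c cE] : exists c : int, c = s k - s' 0 by exists (s k - s' 0).
have sc i : s (k + i) = s' i + c.
  move: i; apply: (int_bi_ind (i0 := 0)) => [|i]; first by rewrite addr0 cE; lia.
  by rewrite (addrA k) sS sS' ba addrAC; split=> [->|/addIr].
have cover j : exists i, s' i <= j < s' (i + 1).
  move: j; apply: (int_bi_ind (i0 := s' 0)) => [|j].
    by exists 0; rewrite sS'; have := b0 0; lia.
  split=> -[i]; rewrite sS' => ij.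
  - have [h|h] := ltP (j + 1) (s' i + (b i)%:Z).
      by exists i; rewrite sS'; lia.
    by exists (i + 1); rewrite !sS'; have := b0 (i + 1); lia.
  - have [h|h] := leP (s' i) j; first by exists i; rewrite sS'; lia.
    exists (i - 1); have := sS' (i - 1); rewrite subrK => E; have := b0 (i - 1).
    by move: ij; rewrite E; lia.
have key (f : bool) : let F d := if f then flip_turn d else d in
    w' (s' 0) = F (w (s k)) -> forall j, w' j = F (w (j + c)).
  move=> F F0 j; have [i ij] := cover j.
  rewrite (sw' _ _ ij) (sw (k + i)); last by move: ij; rewrite sS sS' sc -ba; lia.
  move: i {ij}; apply: (int_bi_ind (i0 := 0)) => [|i]; first by rewrite addr0.
  rewrite (addrA k); move: (sn (k + i)) (sn' i); rewrite /F.
  case: (w' (s' (i + 1))); case: (w' (s' i)) => //; case: (w (s (k + i + 1)));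
    case: (w (s (k + i))) => //; by case: (f).
exists c; case E : (w' (s' 0)); case E' : (w (s k)).
- by left; apply: (key false); rewrite E E'.
- by right; apply: (key true); rewrite E E'.
- by right; apply: (key true); rewrite E E'.
- by left; apply: (key false); rewrite E E'.
Qed.

(** Reversal maps the block s i <= j < s (i + 1) to
    2 - s (i + 1) <= 1 - j < 2 - s i. *)
Lemma block_lengths_reverse (w : int -> turn) (a : int -> nat) :
  block_lengths w a -> block_lengths (fun i => w (1 - i)) (fun i => a (- i)).
Proof.
move=> [a0 [s [sS sw sn]]]; split=> [i|]; first exact: a0.
have sN i : s (1 - i) = s (- i) + (a (- i))%:Z by rewrite -sS addrC.
have wE i : w (1 - (2 - s (1 - i))) = w (s (- i)).
  by apply: sw; rewrite [- i + 1]addrC sN; have := a0 (- i); lia.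
exists (fun i => 2 - s (1 - i)); split=> [i|i j|i].
- rewrite (_ : 1 - (i + 1) = - i); last by lia.
  by rewrite sN opprD addrA subrK.
- rewrite (_ : 1 - (i + 1) = - i); last by lia.
  rewrite wE => ij; apply: sw; move: ij; rewrite sS sN.
  move: (s (- i)) (a (- i)) => x y; lia.
- rewrite !wE => E; apply: (sn (- (i + 1))); rewrite E.
  by congr (w (s _)); lia.
Qed.

Lemma river_blocks_unique (R : realType) (Q Q' : bqf R) (a b : int -> nat) :
  river_blocks Q a -> river_blocks Q' b -> shift_reversal_equiv a b ->
  exists g : 'M[int]_2, g \in unitmx /\
    [set act_edge g E | E in river Q] = river Q'.
Proof.
move=> [p [e [w [/traversal_turn_path T /T [M [MP ->]] wa]]]].
move=> [p' [e' [w' [/traversal_turn_path T' /T' [M' [MP' ->]] wb]]]].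
move=> {p e p' e' T T'} [k kab].
wlog kab' : b k w' M' MP' wb kab / forall i, b i = a (k + i).
  move=> H; case: kab => kab; first by apply: (H b k w' M' MP' wb) => //; left.
  have [] := H _ k _ _ (turn_path_reverse MP') (block_lengths_reverse wb).
  - by left=> i; rewrite kab opprK.
  - by move=> i; rewrite kab opprK.
  move=> g [ug gE]; exists g; split=> //; rewrite gE.
  apply/seteqP; split=> _ [i _ <-]; rewrite ?edge_neg2; first by exists (- i).
  by exists (- i) => //; rewrite edge_neg2 opprK.
have [c ww] := block_lengths_word wa wb kab'.
wlog ww' : w' M' MP' {wb ww} / forall j, w' j = w (j + c).
  case: ww => ww; first by move=> /(_ _ _ MP'); apply.
  move=> /(_ _ _ (turn_path_flip MP')) [].
  - by move=> j; rewrite ww; case: (w _).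
  move=> g [ug gE]; exists g; split=> //; rewrite gE.
  by apply: eq_imagel => i _; rewrite edge_swap.
have [g [ug gE]] := same_word_same_path MP MP' ww'.
exists g; split=> //; apply/seteqP; split.
- by move=> _ [_ [i _ <-] <-]; exists (i - c) => //; rewrite gE subrK.
- by move=> _ [i _ <-]; exists (edge (M (i + c))); rewrite ?gE //; exists (i + c).
Qed.

(** * Linear forms *)

Definition lform (R : realType) (c : R * R) (P : 'cV[R]_2) : R :=
  c.1 * P 0 0 + c.2 * P 1 0.

Lemma lformD (R : realType) (c : R * R) P P' :
  lform c (P + P') = lform c P + lform c P'.
Proof. by rewrite /lform !mxE; ring. Qed.

Lemma lformZ (R : realType) (c : R * R) a P : lform c (a *: P) = a * lform c P.
Proof. by rewrite /lform !mxE; ring. Qed.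

Lemma real_ptD (R : realType) (u v : ivec) :
  real_pt R (u + v) = real_pt R u + real_pt R v.
Proof. exact: raddfD. Qed.

Lemma real_ptZ (R : realType) (k : int) (u : ivec) :
  real_pt R (k *: u) = k%:~R *: real_pt R u.
Proof. by apply/matrixP => i j; rewrite !mxE intrM. Qed.

Definition iform (R : realType) (c : R * R) (v : ivec) : R :=
  lform c (real_pt R v).

Lemma iformD (R : realType) (c : R * R) u v : iform c (u + v) = iform c u + iform c v.
Proof. by rewrite /iform real_ptD lformD. Qed.

Lemma iformZ (R : realType) (c : R * R) k v : iform c (k *: v) = k%:~R * iform c v.
Proof. by rewrite /iform real_ptZ lformZ. Qed.

Lemma iformN (R : realType) (c : R * R) v : iform c (- v) = - iform c v.
Proof. by rewrite -scaleN1r iformZ mulN1r. Qed.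

Lemma iform0 (R : realType) (c : R * R) : iform c 0 = 0.
Proof. by rewrite -(scale0r 0) iformZ mul0r. Qed.

(** The area form expressed in the coordinates given by two linear forms. *)
Lemma iform_det (R : realType) (c d : R * R) u v :
  iform c u * iform d v - iform d u * iform c v =
  (c.1 * d.2 - c.2 * d.1) * (det2 u v)%:~R.
Proof. by rewrite det2E rmorphB !rmorphM /iform /lform !mxE /=; ring. Qed.

(** * The river *)

Section River.

Context (R : realType) (cf cg : R * R).

Local Notation f := (iform cf).
Local Notation g := (iform cg).
Let kappa : R := cf.1 * cg.2 - cf.2 * cg.1.

Hypothesis f_neq0 : forall v, v != 0 -> f v != 0.
Hypothesis g_neq0 : forall v, v != 0 -> g v != 0.

Let fD := iformD cf.
Let gD := iformD cg.
Let fZ := iformZ cf.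
Let gZ := iformZ cg.
Let fN := iformN cf.
Let gN := iformN cg.

(** The representatives of river edges when Q is a multiple of the product of the
    forms cf and cg: the first vector is inside the sector, the second outside.
    The positivity of f on both fixes the signs, and the river flows towards the
    line where g vanishes. *)
Definition river_pair (m : ivec * ivec) : Prop :=
  [/\ 0 < f m.1, 0 < f m.2, 0 < g m.1, g m.2 < 0 & mx2 m.1 m.2 \in unitmx].

Definition river_next (m : ivec * ivec) : ivec * ivec :=
  if 0 < g (m.1 + m.2) then (m.1 + m.2, m.2) else (m.1, m.1 + m.2).

Definition river_prev (m : ivec * ivec) : ivec * ivec :=
  if 0 < f (m.1 - m.2) then (m.1 - m.2, m.2) else (m.1, m.2 - m.1).

(** Replacing the first vector by the sum is a right turn if the first vector is on
    the left, that is, if the determinant is 1, and a left turn otherwise. *)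
Definition river_turn (m : ivec * ivec) : turn :=
  if (0 < g (m.1 + m.2)) == (det2 m.1 m.2 == 1) then TurnR else TurnL.

Lemma river_next_pair m : river_pair m -> river_pair (river_next m).
Proof.
case: m => u v [/= fu fv gu gv /mx2_unitP d].
have h : u + v != 0.
  by apply: contraTneq fu => /eqP; rewrite addr_eq0 => /eqP ->; rewrite fN; lra.
have := g_neq0 h; rewrite neq_lt /river_next /= => /orP[] h'.
  rewrite ltNge (ltW h') /=; split=> //=; rewrite ?fD; try lra.
  by move: d; rewrite mx2_unitP !det2E !mxE /=; lia.
rewrite h'; split=> //=; rewrite ?fD; try lra.
by move: d; rewrite mx2_unitP !det2E !mxE /=; lia.
Qed.

Lemma river_prev_pair m : river_pair m -> river_pair (river_prev m).
Proof.
case: m => u v [/= fu fv gu gv /mx2_unitP d].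
have h : u - v != 0.
  by apply: contraTneq gu => /eqP; rewrite subr_eq0 => /eqP ->; lra.
have := f_neq0 h; rewrite neq_lt /river_prev /= => /orP[] h'.
  rewrite ltNge (ltW h') /=; move: h'; rewrite fD fN => h'.
  split=> //=; rewrite ?fD ?gD ?fN ?gN; try lra.
  by move: d; rewrite mx2_unitP !det2E !mxE /=; lia.
rewrite h'; split=> //=; rewrite ?gD ?gN; try lra.
by move: d; rewrite mx2_unitP !det2E !mxE /=; lia.
Qed.

Lemma river_nextK m : river_pair m -> river_prev (river_next m) = m.
Proof.
case: m => u v [/= fu fv gu gv _]; rewrite /river_next /=; case: ifP => _.
  by rewrite /river_prev /= addrK fu.
rewrite /river_prev /= opprD addrA subrr add0r fN addrAC subrr add0r.
by rewrite ltNge oppr_le0 (ltW fv).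
Qed.

Lemma river_prevK m : river_pair m -> river_next (river_prev m) = m.
Proof.
case: m => u v [/= fu fv gu gv _]; rewrite /river_prev /=; case: ifP => _.
  by rewrite /river_next /= subrK gu.
by rewrite /river_next /= addrC subrK ltNge (ltW gv).
Qed.

Lemma iter_next_pair k m : river_pair m -> river_pair (iter k river_next m).
Proof. by move=> rm; elim: k => //= k; apply: river_next_pair. Qed.

Lemma iter_next_inj k m n : river_pair m -> river_pair n ->
  iter k river_next m = iter k river_next n -> m = n.
Proof.
move=> rm rn; elim: k => //= k IH E; apply: IH.
by rewrite -(river_nextK (iter_next_pair k rm)) E river_nextK //; apply: iter_next_pair.
Qed.

Lemma river_orbit m : river_pair m ->
  exists M : int -> ivec * ivec,
    [/\ M 0 = m, forall i, river_pair (M i) & forall i, M (i + 1) = river_next (M i)].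
Proof.
move=> rm.
have rnext n : river_pair (iter n river_next m).
  by elim: n => //= n; apply: river_next_pair.
have rprev n : river_pair (iter n river_prev m).
  by elim: n => //= n; apply: river_prev_pair.
exists (fun i : int => match i with
  | Posz n => iter n river_next m
  | Negz n => iter n.+1 river_prev m
  end); split=> [//|[] n|[n|[|n]]].
- exact: rnext.
- exact: rprev n.+1.
- by rewrite -PoszD addn1.
- by rewrite /= river_prevK.
- rewrite (_ : Negz n.+1 + 1 = Negz n) //=; first by rewrite river_prevK //; apply: (rprev n.+1).
  by rewrite !NegzE; lia.
Qed.

(** The signs of f and g on a river pair fix the sign of its determinant. *)
Lemma river_pair_det m n : river_pair m -> river_pair n ->
  det2 m.1 m.2 = det2 n.1 n.2.
Proof.
have sgn p : river_pair p -> kappa * (det2 p.1 p.2)%:~R < 0.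
  by case=> fu fv gu gv _; rewrite -iform_det; nra.
move=> rm rn; have := sgn _ rm; have := sgn _ rn.
case: rm rn => _ _ _ _ /mx2_unitP dm [_ _ _ _ /mx2_unitP dn].
by case: dm => ->; case: dn => -> // h1 h2; exfalso; move: h1 h2;
  rewrite rmorphN1 mulr1z; lra.
Qed.

(** A nonnegative matrix of determinant 1 other than the identity has one column
    dominating the other; subtracting the smaller column is exactly a step back
    along the river, because it keeps f positive.  This is the Euclidean algorithm,
    with the sum of the entries as the decreasing measure. *)
Lemma river_descent u v (p q r s : int) :
  0 <= p -> 0 <= q -> 0 <= r -> 0 <= s -> p * s - q * r = 1 ->
  river_pair (u, v) ->
  river_pair (p *: u + r *: v, q *: u + s *: v) ->
  exists k, (p *: u + r *: v, q *: u + s *: v) = iter k river_next (u, v).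
Proof.
have [N] : exists N : nat, p + q + r + s <= N%:Z by exists `|(p + q + r + s)%R|%N; lia.
elim: N p q r s => [|N IH] p q r s pN p0 q0 r0 s0 d ruv; first by nia.
set u' := p *: u + r *: v; set v' := q *: u + s *: v => ruv'.
have [fu fv _ _ _] := ruv; rewrite /= in fu fv.
have prevE k : river_prev (u', v') = iter k river_next (u, v) ->
    exists k, (u', v') = iter k river_next (u, v).
  by move=> E; exists k.+1; rewrite /= -E river_prevK.
have pos (x y : int) : 0 <= x -> 0 <= y -> 0 < x + y -> 0 < f (x *: u + y *: v).
  move=> x0 y0 xy; rewrite fD !fZ.
  have [x1|x1] := eqVneq x 0.
    by rewrite x1 mul0r add0r mulr_gt0 // ltr0z; lia.
  have X1 : 0 < x%:~R * f u by rewrite mulr_gt0 // ltr0z; lia.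
  by rewrite ltr_wpDr // mulr_ge0 ?ler0z // ltW.
have := river_prev_pair ruv'; rewrite /river_prev /= => rprev.
(* p > q and r < s force q = r = 0 and p = s = 1, by the determinant *)
have [[qp sr]|[[pq rs]|[p1 q0' r0' s1]]] : (q <= p /\ s <= r) \/ (p <= q /\ r <= s) \/
    [/\ p = 1, q = 0, r = 0 & s = 1].
- have [h1|h1] := leP q p; have [h2|h2] := leP s r.
  + by left.
  + have [h3|h3] := eqVneq (p + q + r + s) 2; first by right; right; split; nia.
    by right; left; split; nia.
  + by right; nia.
  + by right; left; lia.
- have E : u' - v' = (p - q) *: u + (r - s) *: v.
    by rewrite /u' /v'; apply: cV2P; rewrite !mxE; ring.
  have fuv : 0 < f (u' - v') by rewrite E; apply: pos; nia.
  rewrite fuv E in rprev.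
  have [||||||k kE] := IH (p - q) q (r - s) s _ _ _ _ _ _ ruv rprev; try nia.
  by apply: (prevE k); rewrite /river_prev /= fuv E.
- have E : v' - u' = (q - p) *: u + (s - r) *: v.
    by rewrite /u' /v'; apply: cV2P; rewrite !mxE; ring.
  have fuv : 0 < f (v' - u') by rewrite E; apply: pos; nia.
  have fuvF : (0 < f (u' - v')) = false.
    by apply/negbTE; rewrite -leNgt -opprB fN oppr_le0 ltW.
  rewrite fuvF E in rprev.
  have [||||||k kE] := IH p (q - p) r (s - r) _ _ _ _ _ _ ruv rprev; try nia.
  by apply: (prevE k); rewrite /river_prev /= fuvF E.
- by exists 0%N; rewrite /u' /v' p1 q0' r0' s1 /= !scale1r !scale0r addr0 add0r.
Qed.

(** The signs of f and g on the two pairs make the diagonal entries p and s of the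
    change of basis positive; then q r = p s - 1 is nonnegative, so q and r have
    the same sign, and the matrix or its inverse is nonnegative. *)
Lemma river_connected m n : river_pair m -> river_pair n ->
  exists k, n = iter k river_next m \/ m = iter k river_next n.
Proof.
case: m n => u v [u' v'] rm rn.
have := river_pair_det rm rn; rewrite /= => dmn.
have /mx2_unitP de : mx2 u v \in unitmx by case: rm.
rewrite /= in de.
have [e [eE e1]] : exists e : int, e = det2 u v /\ e * e = 1.
  by exists (det2 u v); split=> //; case: de => ->.
pose p := e * det2 u' v; pose r := e * det2 u u'.
pose q := e * det2 v' v; pose s := e * det2 u v'.
have scal (z : ivec) : z = (e * det2 z v) *: u + (e * det2 u z) *: v.
  by rewrite -!scalerA -scalerDr -cramer2 scalerA -eE e1 scale1r.
have scal' (z : ivec) : z = (e * det2 z v') *: u' + (e * det2 u' z) *: v'.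
  by rewrite -!scalerA -scalerDr -cramer2 scalerA -dmn -eE e1 scale1r.
have u'E : u' = p *: u + r *: v := scal u'.
have v'E : v' = q *: u + s *: v := scal v'.
have uE : u = s *: u' + (- r) *: v'.
  by rewrite [LHS]scal' /s /r; congr (_ *: _ + _ *: _); rewrite !det2E; ring.
have vE : v = (- q) *: u' + p *: v'.
  by rewrite [LHS]scal' /q /p; congr (_ *: _ + _ *: _); rewrite !det2E; ring.
have det : p * s - q * r = 1.
  have : e * e * (det2 u v * det2 u' v') = 1 by rewrite e1 mul1r -dmn -eE.
  by move=> <-; rewrite /p /q /r /s !det2E; ring.
have [fu fv gu gv _] := rm; have [fu' fv' gu' gv' _] := rn.
rewrite /= in fu fv gu gv fu' fv' gu' gv'.
have p0 : 0 < p.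
  rewrite ltNge; apply/negP => p0.
  move: fu' gu'; rewrite u'E fD gD !fZ !gZ.
  have : p%:~R <= 0 :> R by rewrite lerz0.
  by have [r0|r0] := leP r 0; [have : r%:~R <= 0 :> R by rewrite lerz0
    |have : 0 < r%:~R :> R by rewrite ltr0z]; nra.
have s0 : 0 < s.
  rewrite ltNge; apply/negP => s0.
  move: fv' gv'; rewrite v'E fD gD !fZ !gZ.
  have : s%:~R <= 0 :> R by rewrite lerz0.
  by have [r0|r0] := leP q 0; [have : q%:~R <= 0 :> R by rewrite lerz0
    |have : 0 < q%:~R :> R by rewrite ltr0z]; nra.
have [[q0 r0]|[q0 r0]] : (0 <= q /\ 0 <= r) \/ (q <= 0 /\ r <= 0).
  move: det p0 s0; clear; move: p q r s => p q r s det p0 s0.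
  have qr : 0 <= q * r by nia.
  by have [q0|q0|q0] := ltgtP q 0; have [r0|r0] := leP 0 r; (left + right); nia.
- rewrite u'E v'E in rn *.
  have [||||k ->] := @river_descent u v p q r s _ _ _ _ det rm rn; try lia.
  by exists k; left.
- rewrite uE vE in rm *.
  have [|||||k kE] := @river_descent u' v' s (- q) (- r) p _ _ _ _ _ rn rm; try lia.
  by exists k; right.
Qed.

(** The sign of Q at an integer vector is that of B f g, which is invariant under
    v |-> -v, so both vectors of a basis can be normalized by f > 0. *)
Lemma river_pairs (Q : bqf R) (B : R) :
  B != 0 -> (forall P, Q P = B * lform cf P * lform cg P) ->
  river Q = [set edge m | m in river_pair].
Proof.
move=> B0 QE; have QfE x : Q (real_pt R x) = B * (f x * g x) by rewrite QE mulrA.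
have swapU (u v : ivec) : mx2 u v \in unitmx -> mx2 v u \in unitmx.
  by rewrite !mx2_unitP !det2E /=; lia.
apply/seteqP; split; last first.
  move=> _ [[u v] [/= fu fv gu gv uv] <-].
  have [B1|B1|B1] := ltgtP B 0; last by rewrite B1 eqxx in B0.
  - exists v, u; rewrite -edge_swap !QfE; split=> //; first exact: swapU.
    + by rewrite nmulr_rgt0 // pmulr_rlt0.
    + by rewrite nmulr_rlt0 // pmulr_rgt0.
  - exists u, v; rewrite !QfE; split=> //.
    + by rewrite pmulr_rgt0 // pmulr_rgt0.
    + by rewrite pmulr_rlt0 // pmulr_rlt0.
have fpos x : f x * g x != 0 -> exists y, [/\ 0 < f y, f y * g y = f x * g x
    & y = x \/ y = - x].
  rewrite mulf_eq0 negb_or => /andP[]; rewrite neq_lt => /orP[] h _.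
    by exists (- x); rewrite fN gN mulrNN oppr_gt0; split=> //; right.
  by exists x; split=> //; left.
move=> _ [x [y [xy -> Qx Qy]]]; rewrite !QfE in Qx Qy.
have [|u [fu fgu ux]] := fpos x; first by apply: contraTneq Qx => ->; rewrite mulr0 ltxx.
have [|v [fv fgv vy]] := fpos y; first by apply: contraTneq Qy => ->; rewrite mulr0 ltxx.
have -> : [set lax x; lax y] = edge (u, v).
  by case: ux => ->; case: vy => ->; rewrite /edge ?laxN.
have uv : mx2 u v \in unitmx.
  by move: xy; case: ux => ->; case: vy => ->; rewrite !mx2_unitP !det2E ?mxE /=; lia.
rewrite -fgu -fgv in Qx Qy.
have [B1|B1|B1] := ltgtP B 0; last by rewrite B1 eqxx in B0.
- exists (v, u); last exact: (edge_swap (u, v)).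
  split=> //=; last exact: swapU.
  + by move: Qy; rewrite nmulr_rlt0 // pmulr_rgt0.
  + by move: Qx; rewrite nmulr_rgt0 // pmulr_rlt0.
- exists (u, v) => //; split=> //=.
  + by move: Qx; rewrite pmulr_rgt0 // pmulr_rgt0.
  + by move: Qy; rewrite pmulr_rlt0 // pmulr_rlt0.
Qed.

Lemma turn_next m : river_pair m ->
  turns (edge m) (vertex m) (edge (river_next m)) (river_turn m).
Proof.
case: m => u v [/= _ _ _ _ /mx2_unitP d]; rewrite /river_turn /=.
have z x y : lax (- (x + y)) = lax (x + y) :> lax_vector by rewrite laxN.
case: d => d; rewrite d.
- exists u, v, (- (u + v)); split=> //; first by rewrite subrr.
    by rewrite laxN.
  by rewrite /river_next /=; case: ifP => _ /=; rewrite /edge laxN //= setUC.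
- exists v, u, (- (u + v)); split=> //.
  + by move: d; rewrite !det2E /=; lia.
  + by rewrite [v + u]addrC subrr.
  + by rewrite laxN /vertex /= [in RHS](setUC [set lax v]).
  + by rewrite /edge /= setUC.
  by rewrite /river_next /=; case: ifP => _ /=; rewrite /edge laxN //= setUC.
Qed.

Section Traversal.

Variable M : int -> ivec * ivec.
Hypothesis M_pair : forall i, river_pair (M i).
Hypothesis M_next : forall i, M (i + 1) = river_next (M i).

Lemma orbit_iter i n : M (i + n%:Z) = iter n river_next (M i).
Proof.
elim: n => [|n IH]; first by rewrite addr0.
by rewrite intS addrCA addrC M_next IH.
Qed.

Lemma orbit_covers m : river_pair m -> exists i, m = M i.
Proof.
move=> rm; have [k [->|E]] := river_connected (M_pair 0) rm.
  by exists k%:Z; rewrite -orbit_iter add0r.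
exists (- k%:Z); apply: (iter_next_inj (k := k)) => //.
by rewrite -E -orbit_iter addNr.
Qed.

(** The value of f at the newest region is the maximum of |f| around a vertex, and
    it increases along the river. *)
Lemma orbit_vertex_inj : injective (fun i => vertex (M (i - 1))).
Proof.
suff H (i j : int) : i < j -> vertex (M i) <> vertex (M j).
  move=> i j E; have [||//] := ltgtP i j => ij.
  - by case: (@H (i - 1) (j - 1)); first lia.
  - by case: (@H (j - 1) (i - 1)); first lia.
pose F m := f (m.1 + m.2).
have Fnext m : river_pair m -> F m < F (river_next m).
  case: m => u v [/= fu fv _ _ _].
  by rewrite /river_next /F /=; case: ifP => _ /=; rewrite !fD; lra.
have Fle m x : river_pair m -> vertex m (lax x) -> `|f x| <= F m.
  case: m => u v [/= fu fv _ _ _] hx; rewrite /F /= fD.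
  have [y [xy fy]] : exists y, lax x = lax y /\ `|f y| <= f u + f v.
    case: hx => [[|]|] -> /=; [exists u|exists v|exists (u + v)]; split => //.
    - by rewrite gtr0_norm //; lra.
    - by rewrite gtr0_norm //; lra.
    - by rewrite fD gtr0_norm //; lra.
  by case: (lax_eq xy) => -> //; rewrite fN normrN.
move=> ij E.
have FM (n : nat) : F (M i) < F (M (i + n.+1%:Z)).
  elim: n => [|n IH]; first by rewrite M_next Fnext.
  rewrite (_ : i + n.+2%:Z = i + n.+1%:Z + 1); last by lia.
  by rewrite M_next (lt_trans IH) // Fnext.
have := FM `|(j - i - 1)%R|%N; rewrite (_ : i + _ = j); last by lia.
rewrite ltNge => /negP; apply.
have := @Fle (M i) ((M j).1 + (M j).2) (M_pair i).
rewrite E => /(_ (or_intror erefl)); apply: le_trans.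
by rewrite /F; apply: ler_norm.
Qed.

Lemma orbit_traversal (Q : bqf R) (B : R) :
  B != 0 -> (forall P, Q P = B * lform cf P * lform cg P) ->
  river_traversal Q (fun i => vertex (M (i - 1))) (fun i => edge (M i)).
Proof.
move=> B0 QE; split.
- move=> i; rewrite addrK; split.
  + by exists (M i).1, (M i).2; split=> //; case: (M_pair i).
  + exists (M (i - 1)).1, (M (i - 1)).2, (- ((M (i - 1)).1 + (M (i - 1)).2)).
    by split; rewrite ?subrr ?laxN //; case: (M_pair (i - 1)).
  + exists (M i).1, (M i).2, (- ((M i).1 + (M i).2)).
    by split; rewrite ?subrr ?laxN //; case: (M_pair i).
  + move=> E; have := @orbit_vertex_inj i (i + 1); rewrite /= addrK => /(_ E); lia.
  + move=> l il; split; last by left.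
    have iE : M i = river_next (M (i - 1)) by rewrite -M_next subrK.
    move: il; rewrite iE /river_next /vertex /edge; case: ifP => _ /= -[] ->.
    - by right.
    - by left; right.
    - by left; left.
    - by right.
- exact: orbit_vertex_inj.
- rewrite (river_pairs B0 QE); apply/seteqP; split.
  + by move=> _ [m /orbit_covers [i ->] <-]; exists i.
  + by move=> _ [i _ <-]; exists (M i).
Qed.

Lemma orbit_turn_word :
  turn_word (fun i => vertex (M (i - 1))) (fun i => edge (M i))
    (fun i => river_turn (M (i - 1))).
Proof.
move=> i; have := turn_next (M_pair (i - 1)).
by rewrite -M_next subrK.
Qed.

End Traversal.

End River.

(** * From the sail to the blocks of turns *)

Lemma int_sums (a : int -> nat) (s0 : int) :
  exists s : int -> int, s 0 = s0 /\ forall i, s (i + 1) = s i + (a i)%:Z.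
Proof.
exists (fun i : int => match i with
  | Posz n => s0 + \sum_(j < n) (a j%:Z)%:Z
  | Negz n => s0 - \sum_(j < n.+1) (a (- j.+1%:Z)%R)%:Z
  end); split=> [|[n|[|n]]]; first by rewrite /= big_ord0 addr0.
- by rewrite -PoszD addn1 big_ord_recr /= addrA.
- by rewrite /= big_ord0 big_ord1 addr0 subrK.
- rewrite (_ : Negz n.+1 + 1 = Negz n); last by rewrite !NegzE; lia.
  by rewrite [in RHS]big_ord_recr /= opprD addrA subrK.
Qed.

Section Blocks.

Context (R : realType) (cf cg : R * R).

Local Notation f := (iform cf).
Local Notation g := (iform cg).

Hypothesis g_neq0 : forall v, v != 0 -> g v != 0.

Let gE u v (n : nat) : g (u + n%:Z *: v) = g u + n%:R * g v.
Proof. by rewrite iformD iformZ. Qed.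

Let scalerS (u : ivec) n : n.+1%:Z *: u = u + n%:Z *: u.
Proof. by rewrite intS scalerDl scale1r. Qed.

(** As g decreases along v, it is positive all the way to u + l v, so the first
    vector is the one replaced. *)
Lemma iter_next_first u v n l : (n <= l)%N -> g v < 0 -> 0 < g (u + l%:Z *: v) ->
  iter n (river_next cg) (u, v) = (u + n%:Z *: v, v).
Proof.
move=> + gv; rewrite gE => nl gl.
elim: n nl => [|n IH] nl; first by rewrite scale0r addr0.
rewrite /= IH 1?ltnW // /river_next /=.
have -> : u + n%:Z *: v + v = u + n.+1%:Z *: v.
  by rewrite scalerS -addrA [v + _]addrC.
suff gn : 0 < g (u + n.+1%:Z *: v) by rewrite gn.
have : n.+1%:R <= l%:R :> R by rewrite ler_nat.
by rewrite gE; nra.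
Qed.

Lemma iter_next_second u v n l : (n <= l)%N -> 0 < g u -> g (v + l%:Z *: u) < 0 ->
  iter n (river_next cg) (u, v) = (u, v + n%:Z *: u).
Proof.
move=> + gu; rewrite gE => nl gl.
elim: n nl => [|n IH] nl; first by rewrite scale0r addr0.
rewrite /= IH 1?ltnW // /river_next /=.
have -> : u + (v + n%:Z *: u) = v + n.+1%:Z *: u.
  by rewrite scalerS addrCA.
suff gn : (0 < g (v + n.+1%:Z *: u)) = false by rewrite gn.
apply/negbTE; rewrite -leNgt.
have : n.+1%:R <= l%:R :> R by rewrite ler_nat.
by rewrite gE; nra.
Qed.

(** M passes through (A k, v k) at the end of every block of odd index and through
    (A (k + 1), v k) at the end of every block of even index; in between, the same
    vector is replaced at each step. *)
Lemma sail_blocks (M : int -> ivec * ivec) (A v : int -> ivec) (a : int -> nat) :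
  (forall i, river_pair cf cg (M i)) -> (forall i, M (i + 1) = river_next cg (M i)) ->
  M 0 = (A 0, v 0) -> (forall k, river_pair cf cg (A k, v k)) ->
  (forall k, 0 < a (2 * k)%R)%N -> (forall k, 0 < a (2 * k - 1)%R)%N ->
  (forall k, A (k + 1) = A k + (a (2 * k)%R)%:Z *: v k) ->
  (forall k, v k = v (k - 1) + (a (2 * k - 1)%R)%:Z *: A k) ->
  block_lengths (fun i => river_turn cg (M (i - 1))) a.
Proof.
move=> M_pair M_next M0 rp ae ao AE vE.
have Miter := orbit_iter M_next.
have parity (i : int) : exists k : int, i = 2 * k \/ i = 2 * k - 1.
  move: i; apply: (int_bi_ind (i0 := 0)) => [|i]; first by exists 0; left.
  split=> -[k [] kE].
  - by exists (k + 1); right; lia.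
  - by exists k; left; lia.
  - by exists k; right; lia.
  - by exists (k - 1); left; lia.
(* the turn of index j leads from M (j - 1) to M j, and M 0 = (A 0, v 0), so the
   block 0 of turns starts at index 1 *)
have [s [s0 sS]] := int_sums a 1.
have sS2 (k : int) : s (2 * k) = s (2 * k - 1) + (a (2 * k - 1)%R)%:Z by rewrite -sS subrK.
have gA k : 0 < g (A k) by case: (rp k).
have gv k : g (v k) < 0 by case: (rp k).
have step1 (k : int) (n : nat) : (n <= a (2 * k)%R)%N ->
    iter n (river_next cg) (A k, v k) = (A k + n%:Z *: v k, v k).
  by move=> h; apply: (iter_next_first h) => //; rewrite -AE.
have step2 (k : int) (n : nat) : (n <= a (2 * k - 1)%R)%N ->
    iter n (river_next cg) (A k, v (k - 1)) = (A k, v (k - 1) + n%:Z *: A k).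
  by move=> h; apply: (iter_next_second h) => //; rewrite -vE.
have step (k : int) : iter (a (2 * (k + 1) - 1)%R + a (2 * k)%R) (river_next cg) (A k, v k)
            = (A (k + 1), v (k + 1)).
  rewrite iterD step1 // -AE.
  by have := step2 (k + 1) _ (leqnn _); rewrite -vE addrK => ->.
have Me (k : int) : M (s (2 * k) - 1) = (A k, v k).
  move: k; apply: (int_bi_ind (i0 := 0)) => [|k]; first by rewrite mulr0 s0 subrr.
  have -> : s (2 * (k + 1)) - 1 = s (2 * k) - 1 + (a (2 * (k + 1) - 1)%R + a (2 * k)%R)%N%:Z.
    rewrite sS2 (_ : 2 * (k + 1) - 1 = 2 * k + 1) ?sS; last by lia.
    by rewrite PoszD; lia.
  rewrite Miter -step; split=> [-> //|].
  by apply: (@iter_next_inj _ cf cg).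
have Mo (k : int) : M (s (2 * k - 1) - 1) = (A k, v (k - 1)).
  have -> : s (2 * k - 1) - 1 = s (2 * (k - 1)) - 1 + (a (2 * (k - 1)))%:Z.
    by rewrite (_ : 2 * k - 1 = 2 * (k - 1) + 1) ?sS; lia.
  by rewrite Miter Me step1 // -AE subrK.
pose cond (j : int) := 0 < g ((M (j - 1)).1 + (M (j - 1)).2).
have off (x j : int) (n : nat) : x <= j < x + n%:Z -> exists2 m, (m < n)%N & j = x + m%:Z.
  by move=> h; exists `|(j - x)%R|%N; lia.
have ce (k j : int) : s (2 * k) <= j < s (2 * k + 1) -> cond j = true.
  rewrite sS => /off[m mn ->].
  have -> : cond (s (2 * k) + m%:Z) = (0 < g (A k + m%:Z *: v k + v k)).
    by rewrite /cond addrAC Miter Me step1 // ltnW.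
  have := gA (k + 1); rewrite AE -addrA [_ + v k]addrC -scalerS !gE.
  have : m.+1%:R <= (a (2 * k)%R)%:R :> R by rewrite ler_nat.
  by have := gv k; nra.
have co (k j : int) : s (2 * k - 1) <= j < s (2 * k - 1 + 1) -> cond j = false.
  rewrite sS => /off[m mn ->].
  have -> : cond (s (2 * k - 1) + m%:Z) = (0 < g (A k + (v (k - 1) + m%:Z *: A k))).
    by rewrite /cond addrAC Miter Mo step2 // ltnW.
  apply/negbTE; rewrite -leNgt.
  have := gv k; rewrite vE addrCA -scalerS !gE.
  have : m.+1%:R <= (a (2 * k - 1)%R)%:R :> R by rewrite ler_nat.
  by have := gA k; nra.
have a0 i : (0 < a i)%N by have [k [->|->]] := parity i.
have cb (i : int) : exists b : bool, (forall j, s i <= j < s (i + 1) -> cond j = b) /\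
    (forall j, s (i + 1) <= j < s (i + 1 + 1) -> cond j = ~~ b).
  have [k [->|->]] := parity i.
    exists true; split=> j; first exact: ce.
    by rewrite (_ : 2 * k + 1 = 2 * (k + 1) - 1); [exact: co|lia].
  by exists false; split=> j; [exact: co|rewrite subrK; exact: ce].
have dM i : det2 (M i).1 (M i).2 = det2 (M 0).1 (M 0).2.
  exact: river_pair_det (M_pair i) (M_pair 0).
have si (i : int) : s i <= s i < s (i + 1) by rewrite sS; have := a0 i; lia.
split=> //; exists s; split=> // [i j ij|i].
  by have [b [cE _]] := cb i; rewrite /river_turn -!/(cond _) !dM !cE.
have [b [c1 c2]] := cb i; rewrite /river_turn -!/(cond _) !dM (c1 (s i)) // (c2 (s (i + 1))) //.
by case: b {c1 c2}; case: (_ == 1).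
Qed.

End Blocks.

(** * Convex hulls in the plane *)

Lemma lform_continuous (R : realType) (c : R * R) : continuous (lform c).
Proof.
move=> P.
have cM i (k : R) : {for P, continuous (fun P' : 'cV[R]_2 => k * P' i 0)}.
  by apply: continuousM; [exact: cst_continuous|exact: coord_continuous].
exact: (continuousD (cM 0 c.1) (cM 1 c.2)).
Qed.

Lemma open_lform_gt (R : realType) (c : R * R) (t : R) :
  open [set P | t < lform c P].
Proof.
apply: (@open_comp _ _ (lform c) [set x | x > t]); last exact: open_gt.
by move=> x _; exact: lform_continuous.
Qed.

Lemma closed_lform_ge (R : realType) (c : R * R) (t : R) :
  closed [set P | t <= lform c P].
Proof.
apply: (@closed_comp _ _ (lform c) [set x | t <= x]); last exact: closed_ge.
by move=> x _; exact: lform_continuous.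
Qed.

Lemma convex_hull_segment (R : realType) (S : set 'cV[R]_2) (P P' : 'cV[R]_2) (t : R) :
  convex_hull S P -> convex_hull S P' -> 0 <= t -> t <= 1 ->
  convex_hull S (t *: P + (1 - t) *: P').
Proof.
move=> hP hP' t0 t1 A [cA SA].
have := cA P P' (Itv01 t0 t1).
by rewrite !inE => /(_ (hP A (conj cA SA)) (hP' A (conj cA SA))).
Qed.

Lemma convex_hull_triangle (R : realType) (S : set 'cV[R]_2)
    (P1 P2 P3 : 'cV[R]_2) (t1 t2 t3 : R) :
  convex_hull S P1 -> convex_hull S P2 -> convex_hull S P3 ->
  0 < t1 -> 0 < t2 -> 0 <= t3 -> t1 + t2 + t3 = 1 ->
  convex_hull S (t1 *: P1 + t2 *: P2 + t3 *: P3).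
Proof.
move=> h1 h2 h3 p1 p2 p3 e.
have p12 : 0 < t1 + t2 by lra.
have -> : t3 = 1 - (t1 + t2) by lra.
have -> : t1 *: P1 + t2 *: P2 =
    (t1 + t2) *: ((t1 / (t1 + t2)) *: P1 + (1 - t1 / (t1 + t2)) *: P2).
  rewrite scalerDr !scalerA mulrBr mulr1 mulrCA divff ?gt_eqF // mulr1.
  by rewrite addrAC subrr add0r.
apply: convex_hull_segment => //; [|exact: ltW|lra].
apply: convex_hull_segment => //; first by rewrite divr_ge0 // ltW.
by rewrite ler_pdivrMr // mul1r; lra.
Qed.

Lemma convex_hull_closure_ge (R : realType) (S : set 'cV[R]_2) (c : R * R) (t : R) :
  (forall P, S P -> t <= lform c P) ->
  forall P, closure (convex_hull S) P -> t <= lform c P.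
Proof.
move=> St; suff sub : convex_hull S `<=` [set P | t <= lform c P].
  by move=> P /(closureS sub); rewrite -((closure_id _).1 (@closed_lform_ge _ c t)).
apply: smallest_sub => // x y p; rewrite !inE /= => tx ty.
rewrite [X in lform c X](_ : _ = p%:num *: x + (1 - p%:num) *: y) //.
rewrite lformD !lformZ; have p0 : 0 <= p%:num by []; have p1 : p%:num <= 1 by [].
by nra.
Qed.

(** Two points of the hull strictly on both sides of the line A B give two triangles
    that cover a neighbourhood of the midpoint of A B: near it, the barycentric
    coordinates relative to A and B are close to 1/2 in both triangles, and the
    third one is nonnegative in one of them. *)
Lemma convex_hull_interior (R : realType) (S : set 'cV[R]_2) (A B P P' : 'cV[R]_2) :
  convex_hull S A -> convex_hull S B -> convex_hull S P -> convex_hull S P' ->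
  0 < det2 (B - A) (P - A) -> det2 (B - A) (P' - A) < 0 ->
  (convex_hull S)^° ((1 - 2^-1) *: A + 2^-1 *: B).
Proof.
move=> hA hB hP hP' dP dP'.
set m := (1 - 2^-1) *: A + 2^-1 *: B.
(* a X Y, b X Y and det2 (B - A) (X - A) are proportional to the barycentric
   coordinates of X in the triangle A B Y *)
pose a X Y : R := det2 (B - X) (Y - X).
pose b X Y : R := det2 (X - A) (Y - A).
have key k Y X : k != 0 -> convex_hull S Y -> 0 < k * det2 (B - A) (Y - A) ->
    0 < k * a X Y -> 0 < k * b X Y -> 0 <= k * det2 (B - A) (X - A) -> convex_hull S X.
  move=> k0 hY dY pa pb pc.
  have d0 : det2 (B - A) (Y - A) != 0.
    by apply: contraTneq dY => ->; rewrite mulr0 ltxx.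
  have -> : X = (a X Y / det2 (B - A) (Y - A)) *: A + (b X Y / det2 (B - A) (Y - A)) *: B
    + (det2 (B - A) (X - A) / det2 (B - A) (Y - A)) *: Y.
    by move: d0; rewrite /a /b !det2E !mxE => d0; apply: cV2P; rewrite !mxE; field.
  have q x : x / det2 (B - A) (Y - A) = (k * x) / (k * det2 (B - A) (Y - A)).
    by field; rewrite k0 d0.
  apply: convex_hull_triangle => //; try by rewrite q divr_gt0.
    by rewrite q divr_ge0 // ltW.
  by move: d0; rewrite /a /b !det2E !mxE => d0; field.
have oa k Y : open [set X | 0 < k * a X Y].
  rewrite (_ : [set _ | _] = [set X | - (k * det2 B Y) <
      lform (k * (B 1 0 - Y 1 0), k * (Y 0 0 - B 0 0)) X]); first exact: open_lform_gt.
  apply/seteqP; split=> X /=; rewrite /a /lform !det2E !mxE /=; lra.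
have ob k Y : open [set X | 0 < k * b X Y].
  rewrite (_ : [set _ | _] = [set X | k * det2 A (Y - A) <
      lform (k * (Y 1 0 - A 1 0), k * (A 0 0 - Y 0 0)) X]); first exact: open_lform_gt.
  apply/seteqP; split=> X /=; rewrite /b /lform !det2E !mxE /=; lra.
have am Y : a m Y = 2^-1 * det2 (B - A) (Y - A).
  by rewrite /a /m !det2E !mxE; field.
have bm Y : b m Y = 2^-1 * det2 (B - A) (Y - A).
  by rewrite /b /m !det2E !mxE; field.
pose U := ([set X | 0 < 1 * a X P] `&` [set X | 0 < 1 * b X P]) `&`
          ([set X | 0 < -1 * a X P'] `&` [set X | 0 < -1 * b X P']).
have oU : open U by apply: openI; apply: openI.
have Um : U m by rewrite /U /= !am !bm; split; split; lra.
apply: (filterS _ (open_nbhs_nbhs (conj oU Um))) => X [[/= h1 h2] [/= h3 h4]].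
have [h|h] := leP 0 (det2 (B - A) (X - A)).
- by apply: (key 1 P X) => //; lra.
- by apply: (key (-1) P' X) => //; lra.
Qed.

(** * Primitive vectors and integer points *)

Lemma det2_real_pt (R : realType) (u v : ivec) :
  det2 (real_pt R u) (real_pt R v) = (det2 u v)%:~R.
Proof. by rewrite !det2E !mxE rmorphB !rmorphM. Qed.

(** The integer length is the gcd of the coordinates of B - A.  The vector X, whose
    coordinates are Bezout coefficients, witnesses that v is primitive. *)
Lemma integer_length_primitive (R : realType) (A B : ivec) : A != B ->
  exists v X, det2 v X = 1 /\ B = A + (integer_length R A B)%:Z *: v.
Proof.
move=> AB; have [D DE] : exists D, D = B - A by exists (B - A).
have [l lE] : exists l : nat, gcdz (D 0 0) (D 1 0) = l.+1%:Z.
  exists (gcdn `|D 0 0| `|D 1 0|).-1; rewrite prednK // gcdn_gt0 !absz_gt0.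
  rewrite -negb_and; apply: contraNN AB; rewrite DE !mxE !subr_eq0.
  by move=> /andP[/eqP d0 /eqP d1]; apply/eqP/cV2P.
pose v : ivec := \col_i divz (D i 0) l.+1%:Z.
have vE : D = l.+1%:Z *: v.
  have dv0 : (l.+1%:Z %| (D 0 0)%R)%Z by rewrite -lE dvdz_gcdl.
  have dv1 : (l.+1%:Z %| (D 1 0)%R)%Z by rewrite -lE dvdz_gcdr.
  by apply: cV2P; rewrite !mxE mulrC divzK.
have [x [y xy]] := Bezoutz (D 0 0) (D 1 0).
pose X : ivec := \col_i (if i == 0 then - y else x).
have vX : det2 v X = 1.
  move: xy; rewrite lE vE det2E !mxE /= => xy.
  apply: (@mulfI _ l.+1%:Z) => //; rewrite mulr1 -[RHS]xy; ring.
exists v, X; split=> //; suff -> : integer_length R A B = l.+1.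
  by rewrite -vE DE addrC subrK.
rewrite /integer_length; congr _.+1; apply: card_fset_set.
have dZ k : det2 (k *: v) X = k.
  by rewrite -[RHS]mulr1 -vX !det2E !mxE; ring.
rewrite (_ : [set _ | _] = (fun j : nat => A + j.+1%:Z *: v) @` `I_l); last first.
  have AR P : real_pt R P = real_pt R A + real_pt R (P - A).
    by rewrite -real_ptD addrC subrK.
  have BR : real_pt R B = real_pt R A + l.+1%:R *: real_pt R v.
    by rewrite -[B](subrK A) -DE vE addrC real_ptD real_ptZ.
  have seg (t : R) : (1 - t) *: real_pt R A + t *: real_pt R B =
      real_pt R A + (t * l.+1%:R) *: real_pt R v.
    by rewrite BR scalerDr scalerA addrA -scalerDl subrK scale1r.
  apply/seteqP; split=> [P [t [t0 t1]]|_ [j jl <-]].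
    rewrite seg AR => /addrI PA.
    have lt0 : 0 < l.+1%:R :> R by rewrite ltr0n.
    have det_P (z : ivec) : (det2 (P - A) z)%:~R = t * l.+1%:R * (det2 v z)%:~R.
      by rewrite -!det2_real_pt PA !det2E !mxE; ring.
    have dv : det2 v (P - A) = 0.
      apply: (@intr_inj R); have := det_P v; rewrite (_ : det2 v v = 0); last first.
        by rewrite det2E; ring.
      rewrite !mulr0z mulr0 => d0.
      rewrite (_ : det2 v (P - A) = - det2 (P - A) v); last by rewrite !det2E; ring.
      by rewrite mulrNz d0 oppr0.
    (* (v, X) is a basis, and P - A is on the line spanned by v *)
    have PE : P - A = det2 (P - A) X *: v.
      by have := cramer2 v X (P - A); rewrite vX dv scale0r addr0 scale1r.
    have := det_P X; rewrite vX mulr1 => dt.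
    have d0 : 0 < det2 (P - A) X.
      by rewrite -(ltr0z R) dt mulr_gt0.
    have d1 : det2 (P - A) X < l.+1%:Z.
      by rewrite -(ltr_int R) dt -[X in _ < X]mul1r ltr_pM2r.
    exists `|(det2 (P - A) X - 1)%R|%N; first by rewrite /=; lia.
    rewrite (_ : _.+1%:Z = det2 (P - A) X); last by lia.
    by rewrite -PE addrC subrK.
  have jl' : (j.+1 < l.+1)%N by [].
  exists (j.+1%:R / l.+1%:R); split.
  - by rewrite divr_gt0 ?ltr0n.
  - by rewrite ltr_pdivrMr ?ltr0n // mul1r ltr_nat.
  - by rewrite seg real_ptD real_ptZ divfK // pnatr_eq0.
apply: inj_card_eq => i j _ _ /addrI /(congr1 (fun z => det2 z X)).
by rewrite !dZ => -[].
Qed.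

(** Two independent forms are positive at an integer point, since rounding the
    solution of c = d = K changes each form by less than K. *)
Lemma iform_pos_point (R : realType) (c d : R * R) :
  c.1 * d.2 - c.2 * d.1 != 0 ->
  exists X : ivec, 0 < iform c X /\ 0 < iform d X.
Proof.
move=> cd; set D := _ - _ in cd.
pose K : R := 1 + `|c.1| + `|c.2| + `|d.1| + `|d.2|.
pose x := K * (d.2 - c.2) / D; pose y := K * (c.1 - d.1) / D.
have cP : c.1 * x + c.2 * y = K by rewrite /x /y /D in cd *; field.
have dP : d.1 * x + d.2 * y = K by rewrite /x /y /D in cd *; field.
pose X : ivec := \col_i (if i == 0 then Num.floor x else Num.floor y).
have near (e : R * R) : e.1 * x + e.2 * y = K -> `|e.1| + `|e.2| < K ->
    0 < iform e X.
  move=> eP eK; rewrite /iform /lform !mxE /=.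
  have fl (z w : R) : z * w - `|z| <= z * (Num.floor w)%:~R.
    have := floor_le w; have := floorD1_gt w; rewrite intrD1 => h1 h2.
    have := ler_norm z; have := ler_norm (- z); rewrite normrN; nra.
  have := fl e.1 x; have := fl e.2 y; lra.
exists X; split; apply: near => //; rewrite /K.
- by have := normr_ge0 d.1; have := normr_ge0 d.2; lra.
- by have := normr_ge0 c.1; have := normr_ge0 c.2; lra.
Qed.

(** * The sail *)

Lemma absz_signed (x z : int) : x = 1 \/ x = -1 -> 0 < x * z -> `|z|%:Z = x * z.
Proof. by case=> ->; lia. Qed.

Section Sail.

Context (R : realType) (cf cg : R * R).

Local Notation f := (iform cf).
Local Notation g := (iform cg).
Let kappa : R := cf.1 * cg.2 - cf.2 * cg.1.
Let br u v : R := f u * g v - g u * f v.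

Hypothesis kappa_neq0 : kappa != 0.
Hypothesis f_neq0 : forall v, v != 0 -> f v != 0.
Hypothesis g_neq0 : forall v, v != 0 -> g v != 0.

Let fD := iformD cf.
Let gD := iformD cg.
Let fZ := iformZ cf.
Let gZ := iformZ cg.
Let fN := iformN cf.
Let gN := iformN cg.

Let brE u v : br u v = kappa * (det2 u v)%:~R.
Proof. exact: iform_det. Qed.

Definition in_sector (v : ivec) : Prop := 0 < f v /\ 0 < g v.

Definition sector_hull : set 'cV[R]_2 :=
  convex_hull [set real_pt R v | v in in_sector].

Lemma sector_hull_pt v : in_sector v -> sector_hull (real_pt R v).
Proof. by move=> sv; apply: sub_gen_smallest; exists v. Qed.

(** By Cramer's rule the coordinates of v are bounded multiples of |f v| + |g v|, and
    a nonzero integer vector has a coordinate of absolute value at least 1. *)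
Lemma iform_discrete : exists2 e : R, 0 < e &
  forall v, v != 0 -> e <= `|f v| + `|g v|.
Proof.
pose K := 1 + `|cf.1| + `|cf.2| + `|cg.1| + `|cg.2|.
have K0 : 0 < K by rewrite /K; do !(rewrite ltr_wpDr ?normr_ge0 //).
exists (`|kappa| / K); first by rewrite divr_gt0 // normr_gt0.
move=> v v0; rewrite ler_pdivrMr //.
have bound (x : int) (p q : R) : x != 0 -> `|p| + `|q| <= K ->
    kappa * x%:~R = p * f v + q * g v -> `|kappa| <= (`|f v| + `|g v|) * K.
  move=> x0 pq kx.
  have x1 : 1 <= `|x%:~R| :> R.
    by rewrite -intr_norm -[X in X <= _]/(1%:~R) ler_int; move: x0; lia.
  apply: (@le_trans _ _ (`|kappa| * `|x%:~R|)); first by rewrite ler_peMr.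
  rewrite -normrM kx; apply: le_trans (ler_normD _ _) _; rewrite !normrM.
  have := normr_ge0 p; have := normr_ge0 q.
  have := normr_ge0 (f v); have := normr_ge0 (g v); nra.
have [x0|x0] := eqVneq (v 0 0) 0; last first.
  apply: (bound _ cg.2 (- cf.2) x0); last by rewrite /kappa /iform /lform !mxE; ring.
  by rewrite normrN /K; have := normr_ge0 cf.1; have := normr_ge0 cg.1; lra.
have y0 : v 1 0 != 0 by apply: contraNN v0 => /eqP y0; apply/eqP/cV2P; rewrite mxE.
apply: (bound _ (- cg.1) cf.1 y0); last by rewrite /kappa /iform /lform !mxE; ring.
by rewrite normrN /K; have := normr_ge0 cf.2; have := normr_ge0 cg.2; lra.
Qed.

(** Nonnegativity of f and g passes to the closure of the hull, and so does the
    positive lower bound of f + g, which excludes the origin. *)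
Lemma closure_sector_hull v : closure sector_hull (real_pt R v) -> in_sector v.
Proof.
move=> clv; have [e e0 eP] := iform_discrete.
have ge c t : (forall u, in_sector u -> t <= lform c (real_pt R u)) ->
    t <= lform c (real_pt R v).
  by move=> h; apply: convex_hull_closure_ge clv => _ [u su <-]; apply: h.
have fv : 0 <= f v by apply: ge => u [fu _]; rewrite ltW.
have gv : 0 <= g v by apply: ge => u [_ gu]; rewrite ltW.
have v0 : v != 0.
  have := ge (cf.1 + cg.1, cf.2 + cg.2) e.
  have sumE u : lform (cf.1 + cg.1, cf.2 + cg.2) (real_pt R u) = f u + g u.
    by rewrite /iform /lform /=; ring.
  rewrite sumE => /(_ _) h; apply: contraTneq e0 => v0.
  have {h} : e <= f v + g v.
    apply: h => u [fu gu]; rewrite sumE -[f u]gtr0_norm // -[g u]gtr0_norm //.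
    by apply: eP; apply: contraTneq fu => ->; rewrite iform0 ltxx.
  by rewrite v0 !iform0 addr0 -leNgt.
by split; rewrite lt_neqAle eq_sym ?f_neq0 ?g_neq0.
Qed.

(** No line in a direction v interior to the sector supports the hull: the sector
    contains integer points X and Y whose directions are on the two sides of v, and
    large multiples of X and Y are on the two sides of the line through A. *)
Lemma sector_both_sides v A : 0 < f v -> 0 < g v ->
  exists P P', [/\ in_sector P, in_sector P', 0 < br v (P - A) & br v (P' - A) < 0].
Proof.
move=> fv gv.
have multiple w X : 0 < br w X -> exists n : nat, 0 < br w (n.+1%:Z *: X - A).
  move=> X0; exists (Num.truncn (`|br w A| / br w X)).
  have := truncnS_gt (`|br w A| / br w X); rewrite ltr_pdivrMr //.
  rewrite /br !fD !gD !fN !gN !fZ !gZ -/(br w X).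
  by have := ler_norm (br w A); rewrite /br; lra.
have [|X [X1 X2]] := @iform_pos_point R (f v * cg.1 - g v * cf.1, f v * cg.2 - g v * cf.2) cf.
  rewrite /= (_ : _ - _ = - (f v * kappa)); last by rewrite /kappa; ring.
  by rewrite oppr_eq0 mulf_neq0 // gt_eqF.
have [|Y [Y1 Y2]] := @iform_pos_point R (g v * cf.1 - f v * cg.1, g v * cf.2 - f v * cg.2) cg.
  rewrite /= (_ : _ - _ = (g v * kappa)); last by rewrite /kappa; ring.
  by rewrite mulf_neq0 // gt_eqF.
have bX : 0 < br v X by move: X1; rewrite /br /iform /lform /=; lra.
have bY : br v Y < 0 by move: Y1; rewrite /br /iform /lform /=; lra.
have gX : 0 < g X by move: X2 bX; rewrite /br; nra.
have fY : 0 < f Y by move: Y2 bY; rewrite /br; nra.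
have [n nX] := multiple v X bX.
have brN P : br (- v) P = - br v P by rewrite /br fN gN; ring.
have [|m] := multiple (- v) Y; first by rewrite brN oppr_gt0.
rewrite brN oppr_gt0 => mY.
exists (n.+1%:Z *: X), (m.+1%:Z *: Y); split=> //; split;
  by rewrite ?fZ ?gZ mulr_gt0 // ltr0z.
Qed.

(** Let d = |det (v, A)|.  The line parallel to v at the height d - 1 over the
    origin, where A has height d, meets the triangle O, A, A + v in (d - 1) / d times
    a translate of v; this segment contains an integer point P, with
    d P = (d - 1 - k) A + k (A + v) for the residue k modulo d of the coefficient
    of A along v.  If d > 1, then P is in the sector and below A. *)
Lemma lowest_triangle_unimodular v X A : det2 v X = 1 ->
  in_sector A -> in_sector (A + v) -> 0 < f v * br v A ->
  (forall P, in_sector P -> f v * br v A <= f v * br v P) ->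
  det2 v A = 1 \/ det2 v A = -1.
Proof.
move=> vX [fA gA] [fAv gAv] bA low.
have [s [d [s1 d0 dE]]] : exists s d : int, [/\ s * s = 1, 0 < d & det2 v A = s * d].
  have [h|h|h] := ltgtP (det2 v A) 0.
  - by exists (-1), (- det2 v A); split; lia.
  - by exists 1, (det2 v A); split; lia.
  - by move: bA; rewrite brE h mulr0z !mulr0 ltxx.
have [d1|d1] := leP d 1.
  have -> : det2 v A = s by rewrite dE (_ : d = 1) ?mulr1 //; lia.
  by nia.
exfalso.
pose c := det2 A X; pose q := divz c d; pose k := modz c d.
have cE : c = q * d + k by exact: divz_eq.
have k0 : 0 <= k by rewrite modz_ge0 // gt_eqF.
have kd : k < d by rewrite ltz_pmod.
have AE : A = c *: v + (s * d) *: X.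
  by have := cramer2 v X A; rewrite vX scale1r dE.
pose P := ((d - 1) * s) *: X + (c - q) *: v.
have dP : d *: P = (d - 1 - k) *: A + k *: (A + v).
  rewrite AE /P; apply: cV2P; rewrite !mxE cE; ring.
have dR : 0 < d%:~R :> R by rewrite ltr0z.
have h1 : 0 <= (d - 1 - k)%:~R :> R by rewrite ler0z; lia.
have h2 : 0 <= k%:~R :> R by rewrite ler0z.
have h3 : 0 < (d - 1 - k)%:~R + k%:~R :> R by rewrite -intrD ltr0z; lia.
have pos (x y a b : R) : 0 <= x -> 0 <= y -> 0 < x + y -> 0 < a -> 0 < b -> 0 < x * a + y * b.
  move=> x0 y0 xy a0 b0; have [x1|x1] := ltP 0 x.
    by rewrite ltr_wpDr ?mulr_gt0 // mulr_ge0 // ltW.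
  by rewrite ltr_wpDl ?mulr_ge0 // ?(ltW a0) // mulr_gt0 //; lra.
have fP : 0 < f P by rewrite -(pmulr_rgt0 _ dR) -fZ dP fD !fZ pos.
have gP : 0 < g P by rewrite -(pmulr_rgt0 _ dR) -gZ dP gD !gZ pos.
have := low P (conj fP gP); rewrite -(ler_pM2l dR).
have bP : d%:~R * br v P = (d - 1)%:~R * br v A.
  transitivity (br v (d *: P)); first by rewrite /br fZ gZ; ring.
  by rewrite dP /br fD gD !fZ !gZ fD gD !intrB; ring.
rewrite mulrCA [X in _ <= X]mulrCA bP intrB; lra.
Qed.

(** The midpoint of A B is not interior to the hull, so the integer points of the
    sector are on one side of the line A B; 2 A shows which one.  The factor f v
    makes the statement independent of the orientation of the edge: the form
    f v * br v is positive on the sector and is minimal along A B. *)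
Lemma hull_edge A B l v X :
  in_sector A -> in_sector B -> det2 v X = 1 -> B = A + l%:Z *: v -> (0 < l)%N ->
  ~ (sector_hull^°) ((1 - 2^-1) *: real_pt R A + 2^-1 *: real_pt R B) ->
  [/\ f v * g v < 0, 0 < f v * br v A, det2 v A = 1 \/ det2 v A = -1 &
      forall P, in_sector P -> f v * br v A <= f v * br v P].
Proof.
move=> sA sB vX BE l0 notint.
have lR : 0 < l%:R :> R by rewrite ltr0n.
have side w P P' : w = v \/ w = - v -> in_sector P -> in_sector P' ->
    0 < br w (P - A) -> br w (P' - A) < 0 -> False.
  have main (Y Y' : ivec) : in_sector Y -> in_sector Y' ->
      0 < det2 v (Y - A) -> det2 v (Y' - A) < 0 -> False.
    move=> sY sY' dY dY'; apply: notint.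
    have dE Z : det2 (real_pt R B - real_pt R A) (real_pt R Z - real_pt R A) =
        l%:R * (det2 v (Z - A))%:~R.
      by rewrite BE -det2_real_pt !real_ptD real_ptZ !det2E !mxE /=; ring.
    apply: (@convex_hull_interior _ _ _ _ (real_pt R Y) (real_pt R Y'));
      try exact: sector_hull_pt.
    - by rewrite dE mulr_gt0 // ltr0z.
    - by rewrite dE pmulr_rlt0 // ltrz0.
  move=> ww sP sP'.
  suff [k [k0 kE]] : exists k : R, k != 0 /\ forall Y, br w Y = k * (det2 v Y)%:~R.
    rewrite !kE; move: k0; rewrite neq_lt => /orP[] k0.
    - rewrite nmulr_rgt0 // nmulr_rlt0 // ltr0z ltrz0 => h h'; exact: main h' h.
    - rewrite pmulr_rgt0 // pmulr_rlt0 // ltr0z ltrz0; exact: main.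
  case: ww => ->; first by exists kappa; split.
  exists (- kappa); split=> [|Y]; first by rewrite oppr_eq0.
  by rewrite mulNr -brE /br fN gN; ring.
have v0 : v != 0 by apply: contra_eqN vX => /eqP ->; rewrite det2E !mxE !mul0r mulr0 subrr.
have brA P : br v (P - A) = br v P - br v A by rewrite /br !fD !gD fN gN; ring.
have fg : f v * g v < 0.
  rewrite ltNge; apply/negP => fg.
  have := f_neq0 v0; rewrite neq_lt => /orP[] fv.
  - have [||P [P' [sP sP' h h']]] := @sector_both_sides (- v) A.
    + by rewrite fN oppr_gt0.
    + by have := g_neq0 v0; rewrite gN neq_lt oppr_gt0 => /orP[//|]; nra.
    by apply: (@side (- v) P P') => //; right.
  - have [||P [P' [sP sP' h h']]] := @sector_both_sides v A => //.
      by have := g_neq0 v0; rewrite neq_lt => /orP[|//]; nra.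
    by apply: (@side v P P') => //; left.
have [fA gA] := sA; have [fB gB] := sB.
have bA : 0 < f v * br v A.
  have := f_neq0 v0; rewrite /br neq_lt => /orP[] fv; nra.
have low P : in_sector P -> f v * br v A <= f v * br v P.
  move=> sP; rewrite leNgt; apply/negP => lt.
  have s2 : in_sector (2%:Z *: A) by split; rewrite ?fZ ?gZ mulr_gt0.
  have b2 : br v (2%:Z *: A - A) = br v A by rewrite brA /br fZ gZ; ring.
  have bP := brA P.
  have := f_neq0 v0; rewrite neq_lt => /orP[] fv.
  - by apply: (@side v P (2%:Z *: A)) => //; [by left|rewrite bP; nra|rewrite b2; nra].
  - by apply: (@side v (2%:Z *: A) P) => //; [by left|rewrite b2; nra|rewrite bP; nra].
split=> //; apply: (@lowest_triangle_unimodular v X A) => //.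
move: fB gB; rewrite BE fD gD fZ gZ => fB gB.
have l1 : 1 <= l%:R :> R by rewrite ler1n.
by split; rewrite ?fD ?gD; rewrite -?[l%:~R]/(l%:R) in fB gB; nra.
Qed.

(** Evaluating the form that supports one edge at the other endpoint of the
    adjacent edge shows that br v v' has the sign of both f v and f v': the edges
    advance in the same direction and the sail turns away from the origin.  Then
    v' - v is a multiple of A, as v and v' have the same determinant with A. *)
Lemma sail_vertex A v v' l l' :
  in_sector A -> in_sector (A - l%:Z *: v) -> in_sector (A + l'%:Z *: v') ->
  (0 < l)%N -> (0 < l')%N -> det2 v v' != 0 ->
  f v * g v < 0 -> f v' * g v' < 0 ->
  (det2 v A = 1 \/ det2 v A = -1) -> (det2 v' A = 1 \/ det2 v' A = -1) ->
  (forall P, in_sector P -> f v * br v A <= f v * br v P) ->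
  (forall P, in_sector P -> f v' * br v' A <= f v' * br v' P) ->
  0 < f v * f v' /\ v' = v + `|det2 v v'|%:Z *: A.
Proof.
move=> sA sB sB' l0 l0' vv' fg fg' d d' low low'.
have [fA gA] := sA.
have lR : 0 < l%:R :> R by rewrite ltr0n.
have lR' : 0 < l'%:R :> R by rewrite ltr0n.
have b0 : 0 <= f v * br v v'.
  rewrite -(pmulr_rge0 _ lR').
  by have := low _ sB'; rewrite /br fD gD fZ gZ -[l'%:~R]/(l'%:R); lra.
have b0' : 0 <= f v' * br v v'.
  rewrite -(pmulr_rge0 _ lR).
  by have := low' _ sB; rewrite /br fD gD fN gN fZ gZ -[l%:~R]/(l%:R); lra.
have bn : br v v' != 0 by rewrite brE mulf_neq0 // intr_eq0.
have fv0 : f v != 0 by apply: contraTneq fg => ->; rewrite mul0r ltxx.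
have fv0' : f v' != 0 by apply: contraTneq fg' => ->; rewrite mul0r ltxx.
have bvv' : 0 < f v * br v v' by rewrite lt_neqAle b0 andbT eq_sym mulf_neq0.
have ff : 0 < f v * f v'.
  have : 0 < f v' * br v v' by rewrite lt_neqAle b0' andbT eq_sym mulf_neq0.
  move: bn; rewrite neq_lt => /orP[] bn; move: bvv'.
    by rewrite !nmulr_lgt0 //; nra.
  by rewrite !pmulr_lgt0 //; nra.
split=> //.
have bvA : 0 < f v * br v A by rewrite /br; nra.
have bvA' : 0 < f v' * br v' A by rewrite /br; nra.
have e1 : det2 v' A = det2 v A.
  move: bvA bvA'; rewrite !brE.
  by case: d => ->; case: d' => ->; rewrite ?rmorphN1 ?rmorph1 => // h h'; exfalso; nra.
have e2 : 0 < det2 v A * det2 v v'.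
  have aux (x y z w : R) : 0 < x * (y * z) -> 0 < x * (y * w) -> 0 < z * w.
    move=> h h'.
    have xy : x * y != 0 by apply: contraTneq h => xy; rewrite mulrA xy mul0r ltxx.
    have xy2 : 0 < (x * y) ^+ 2 by rewrite lt_neqAle sqr_ge0 andbT eq_sym expf_neq0.
    have e : x * (y * z) * (x * (y * w)) = (x * y) ^+ 2 * (z * w) by ring.
    by have := mulr_gt0 h h'; rewrite e (pmulr_rgt0 _ xy2).
  by rewrite -(ltr0z R) intrM; apply: (aux (f v) kappa); rewrite -brE.
have := cramer2 v A v'; rewrite e1.
have -> : `|det2 v v'|%:Z = det2 v A * det2 v v' by exact: absz_signed.
case: d => ->; first by rewrite !scale1r mul1r.
by rewrite !scaleN1r mulN1r scaleNr => /eqP; rewrite eqr_oppLR opprD opprK => /eqP.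
Qed.

(** The sine is |det (v (k - 1), v k)| once the integer lengths have been divided
    out. *)
Lemma sail_structure (A : int -> ivec) :
  broken_line_vertices (boundary sector_hull) A ->
  exists v : int -> ivec,
    [/\ forall k : int, in_sector (A k),
        forall k : int, det2 (v k) (A k) = 1 \/ det2 (v k) (A k) = -1,
        forall k : int, A (k + 1) = A k + (integer_length R (A k) (A (k + 1)))%:Z *: v k,
        forall k : int, (0 < integer_sine R (A (k - 1)%R) (A k) (A (k + 1)%R))%N /\
          v k = v (k - 1) + (integer_sine R (A (k - 1)) (A k) (A (k + 1)))%:Z *: A k
      & (forall k : int, 0 < f (v k) /\ g (v k) < 0) \/
        (forall k : int, 0 < g (v k) /\ f (v k) < 0)].
Proof.
move=> [SE corner _].
pose l (k : int) := integer_length R (A k) (A (k + 1)).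
have onS (k : int) (t : R) : 0 <= t -> t <= 1 -> boundary sector_hull
    ((1 - t) *: real_pt R (A k) + t *: real_pt R (A (k + 1))).
  by move=> t0 t1; rewrite SE; exists k => //; exists t.
have sA (k : int) : in_sector (A k).
  apply: closure_sector_hull; have [] := onS k 0 (lexx _) ler01.
  by rewrite subr0 scale1r scale0r addr0.
have nA (k : int) : A k != A (k + 1).
  apply: contraTneq (corner k) => <-; rewrite subrr !det2E !mxE mulr0 mul0r subrr.
  by rewrite eqxx.
have /boolp.choice [v vP] : forall k : int, exists v : ivec,
    (exists X, det2 v X = 1) /\ A (k + 1) = A k + (l k)%:Z *: v.
  move=> k; have [v [X [vX AE]]] := integer_length_primitive R (nA k).
  by exists v; split=> //; exists X.
have AE (k : int) : A (k + 1) = A k + (l k)%:Z *: v k by have [] := vP k.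
have edgeP (k : int) : [/\ f (v k) * g (v k) < 0, 0 < f (v k) * br (v k) (A k),
    det2 (v k) (A k) = 1 \/ det2 (v k) (A k) = -1 &
    forall P, in_sector P -> f (v k) * br (v k) (A k) <= f (v k) * br (v k) P].
  have [[X vX] _] := vP k.
  apply: (hull_edge (sA k) (sA (k + 1)) vX (AE k)) => //.
  by have [||_] := onS k 2^-1; rewrite ?invr_ge0 ?invf_le1 ?ler1n ?ltr0n.
have AE' (k : int) : A k = A (k - 1) + (l (k - 1))%:Z *: v (k - 1) by rewrite -AE subrK.
have dvA (k : int) : det2 (v (k - 1)) (A k) = det2 (v (k - 1)) (A (k - 1)).
  by rewrite AE' !det2E !mxE; ring.
have vv (k : int) : det2 (A k - A (k - 1)) (A (k + 1) - A k) =
    (l (k - 1))%:Z * (l k)%:Z * det2 (v (k - 1)) (v k).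
  have dA i : A (i + 1) - A i = (l i)%:Z *: v i by rewrite AE addrC addKr.
  have dA' : A k - A (k - 1) = (l (k - 1))%:Z *: v (k - 1) by rewrite -dA subrK.
  by rewrite dA dA' !det2E !mxE; ring.
have turn (k : int) : 0 < f (v (k - 1)) * f (v k) /\
    v k = v (k - 1) + `|det2 (v (k - 1)) (v k)|%:Z *: A k.
  have [fg _ d low] := edgeP (k - 1); have [fg' _ d' low'] := edgeP k.
  apply: (@sail_vertex (A k) (v (k - 1)) (v k) (l (k - 1)) (l k)) => //.
  - by rewrite [A k]AE' addrK.
  - by rewrite -AE.
  - by apply: contraNneq (corner k) => d0; rewrite vv d0 mulr0.
  - by rewrite dvA.
  - by move=> P /low; rewrite !brE dvA.
have sineE (k : int) : integer_sine R (A (k - 1)) (A k) (A (k + 1)) = `|det2 (v (k - 1)%R) (v k)|%N.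
  rewrite /integer_sine /integer_area vv.
  have -> : integer_length R (A (k - 1)) (A k) = l (k - 1) by rewrite /l subrK.
  by rewrite -/(l k) !abszM !absz_nat mulKn.
exists v; split=> // [k|k|].
- by have [] := edgeP k.
- rewrite sineE; split; last by have [] := turn k.
  by rewrite absz_gt0; apply: contraNneq (corner k) => d0; rewrite vv d0 mulr0.
have same (k : int) : 0 < f (v 0) * f (v k).
  have f0 : f (v 0) != 0.
    by have [fg _ _ _] := edgeP 0; apply: contraTneq fg => ->; rewrite mul0r ltxx.
  move: k; apply: (int_bi_ind (i0 := 0)) => [|k].
    by rewrite -expr2 lt_neqAle sqr_ge0 andbT eq_sym expf_neq0.
  have [+ _] := turn (k + 1); rewrite addrK => t.
  by split=> h; nra.
have [fg0 _ _ _] := edgeP 0.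
have : f (v 0) != 0 by apply: contraTneq fg0 => ->; rewrite mul0r ltxx.
rewrite neq_lt => /orP[] f0; [right|left] => k; have := same k; have [fg _ _ _] := edgeP k.
- by rewrite nmulr_rgt0 // => fk; split=> //; move: fg; rewrite nmulr_rlt0.
- by rewrite pmulr_rgt0 // => fk; split=> //; move: fg; rewrite pmulr_rlt0.
Qed.

End Sail.

(** The vertices of the sail are listed towards the line where cg vanishes, which
    is also the direction of [river_next]. *)
Lemma sail_river (R : realType) (cf cg : R * R) (Q : bqf R) (B : R)
    (A v : int -> ivec) (a : int -> nat) :
  (forall u, u != 0 -> iform cf u != 0) ->
  (forall u, u != 0 -> iform cg u != 0) ->
  B != 0 -> (forall P, Q P = B * lform cf P * lform cg P) ->
  (forall k : int, in_sector cf cg (A k)) ->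
  (forall k : int, det2 (v k) (A k) = 1 \/ det2 (v k) (A k) = -1) ->
  (forall k : int, 0 < iform cf (v k) /\ iform cg (v k) < 0) ->
  (forall k : int, 0 < a (2 * k)%R)%N -> (forall k : int, 0 < a (2 * k - 1)%R)%N ->
  (forall k : int, A (k + 1) = A k + (a (2 * k)%R)%:Z *: v k) ->
  (forall k : int, v k = v (k - 1) + (a (2 * k - 1)%R)%:Z *: A k) ->
  river_blocks Q a.
Proof.
move=> f0 g0 B0 QE sA dA sv ae ao AE vE.
have rp (k : int) : river_pair cf cg (A k, v k).
  have [fA gA] := sA k; have [fv gv] := sv k; split=> //=.
  by apply/mx2_unitP; have := dA k; rewrite !det2E /=; lia.
have [M [M0 M_pair M_next]] := river_orbit f0 g0 (rp 0).
exists (fun i => vertex (M (i - 1))), (fun i => edge (M i)).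
eexists; split.
- exact: (orbit_traversal f0 g0 M_pair M_next B0 QE).
- exact: (orbit_turn_word M_pair M_next).
- exact: (sail_blocks g0 M_pair M_next M0 rp ae ao AE vE).
Qed.

Theorem theorem1 (R : realType) (Q : bqf R) (C : set 'cV[R]_2)
    (a : int -> nat) :
  indefinite Q -> no_integer_zero Q -> is_angle Q C -> is_LLS C a ->
  (exists b : int -> nat, river_blocks Q b /\ shift_reversal_equiv a b) /\
  (forall (Q' : bqf R) (b' : int -> nat),
     indefinite Q' -> no_integer_zero Q' ->
     river_blocks Q' b' -> shift_reversal_equiv a b' ->
     exists g : 'M[int]_2, g \in unitmx /\
       [set act_edge g E | E in river Q] = river Q').
Proof.
move=> [[p Qp] _ _] nz [u [w [Qu Qw uw CE]]] [A [Avert LLS]].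
suff ra : river_blocks Q a.
  split; first by exists a; split=> //; exists 0; left=> i; rewrite add0r.
  by move=> Q' b' _ _ rb' ab'; exact: river_blocks_unique ra rb' ab'.
pose D := det2 u w.
(* the coordinates of a point in the basis (u, w); B is the polar form of Q at u, w *)
pose cf := (w 1 0 / D, - w 0 0 / D); pose cg := (- u 1 0 / D, u 0 0 / D).
pose B := 2 * bqf_a Q * u 0 0 * w 0 0 + bqf_h Q * (u 0 0 * w 1 0 + u 1 0 * w 0 0)
  + 2 * bqf_b Q * u 1 0 * w 1 0.
have D0 : u 0 0 * w 1 0 - w 0 0 * u 1 0 != 0 by rewrite -det2E.
have decomp P : P = lform cf P *: u + lform cg P *: w.
  by apply: cV2P; rewrite /lform /cf /cg /D det2E !mxE /=; field.
have QE P : Q P = B * lform cf P * lform cg P.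
  rewrite {1}[P]decomp; move: (lform cf P) (lform cg P) => s t.
  have -> : Q (s *: u + t *: w) = s ^+ 2 * Q u + t ^+ 2 * Q w + B * s * t.
    by rewrite /bqf_eval /B !mxE; ring.
  by rewrite Qu Qw !mulr0 !add0r.
have B0 : B != 0 by apply: contraTneq Qp => B0; rewrite QE B0 !mul0r ltxx.
have f0 v : v != 0 -> iform cf v != 0.
  by apply: contraNN => /eqP fv; apply/eqP/nz; rewrite QE -!/(iform _ _) fv mulr0 mul0r.
have g0 v : v != 0 -> iform cg v != 0.
  by apply: contraNN => /eqP gv; apply/eqP/nz; rewrite QE -!/(iform _ _) gv mulr0.
have kappa0 : cf.1 * cg.2 - cf.2 * cg.1 != 0.
  rewrite (_ : _ - _ = D^-1) ?invr_eq0 //.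
  by rewrite /cf /cg /D det2E /=; field.
have coordE s t : lform cf (s *: u + t *: w) = s /\ lform cg (s *: u + t *: w) = t.
  by rewrite /lform /cf /cg /D det2E !mxE /=; split; field.
have hullE : sail C = boundary (sector_hull cf cg).
  rewrite /sail /sector_hull; congr (boundary (convex_hull _)).
  apply/seteqP; split=> _ [v + <-]; rewrite CE.
  - move=> [v0 [s [t [s0 t0 vE]]]]; exists v => //; move: (f0 _ v0) (g0 _ v0).
    have [fE gE] := coordE s t; rewrite /in_sector /iform vE fE gE => s1 t1.
    by split; rewrite lt_neqAle eq_sym ?s1 ?t1.
  - move=> [fv gv]; exists v => //; split.
      by apply: contraTneq fv => ->; rewrite iform0 ltxx.
    by exists (iform cf v), (iform cg v); rewrite !ltW -?decomp.
rewrite hullE in Avert.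
have [v [sA dA AE vE dir]] := sail_structure kappa0 f0 g0 Avert.
have ae (k : int) : (0 < a (2 * k)%R)%N by have [-> _] := LLS k.
have ao (k : int) : (0 < a (2 * k - 1)%R)%N by have [_ ->] := LLS k; have [] := vE k.
have AE' (k : int) : A (k + 1) = A k + (a (2 * k)%R)%:Z *: v k by have [-> _] := LLS k.
have vE' (k : int) : v k = v (k - 1) + (a (2 * k - 1)%R)%:Z *: A k.
  by have [_ ->] := LLS k; have [] := vE k.
(* if the vertices of the sail are listed towards the line where cf vanishes, then
   the river is traversed in that direction, exchanging the roles of the forms *)
case: dir => dir; first exact: (sail_river f0 g0 B0 QE sA dA dir ae ao AE' vE').
apply: (sail_river g0 f0 B0 _ _ dA dir ae ao AE' vE').
- by move=> P; rewrite QE mulrAC.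
- by move=> k; have [] := sA k.
Qed.
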